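(* Assume $D$ is totally transcendental. (1) For every $(D,\aleph_0)$-homogeneous model $M$ there exists a minimal type $q(x,\bar c)$ with $\bar c\in M$. (2) Minimal types are regular. Moreover, if $q(x,\bar c)$ is minimal, then for every $A$ containing $\bar c$, every set $B$ and every $a\models q_A$: $\operatorname{tp}(a,A\cup B)$ is big if and only if $a\perp_A B$.
   Context: Setting. $T$ is a first-order theory in a language $L(T)$ (with $|T|$ infinite: the number of $L(T)$-formulas), $\overline M$ is a very large saturated model of $T$; all sets are subsets of $\overline M$, all models are elementary submodels of $\overline M$. Barred letters are finite sequences; $\bar a\in A$ means all entries lie in $A$. $\operatorname{tp}(\bar c,A)$ is the complete type of $\bar c$ over $A$ in $\overline M$. $D(T)$ is the set of complete types over $\emptyset$ in finitely many variables. For a set of formulas $p$, $\operatorname{dom}(p)$ is the set of its parameters, $p$ is over $A$ if $\operatorname{dom}(p)\subseteq A$, $p\restriction B$ is the set of formulas of $p$ with parameters in $B$, and $p(M)$ is the set of realizations of $p$ in $M$. Fix $D\subseteq D(T)$. $A$ is a $D$-set if $\operatorname{tp}(\bar c,\emptyset)\in D$ for all $\bar c\in A$; a $D$-model is a model whose universe is a $D$-set. $S_D(A)$ is the set of complete types $p$ over $A$ (in finitely many variables) such that $A\cup\bar c$ is a $D$-set whenever $\bar c\models p$. A $D$-model $M$ is $(D,\lambda)$-homogeneous if it realizes every $p\in S_D(A)$ with $A\subseteq M$, $|A|<\lambda$. Standing hypothesis: $\mathfrak{C}$ is a fixed $(D,\chi)$-homogeneous model (of cardinality at least $\chi$), where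 $\chi$ is larger than all cardinals considered; all $D$-sets and $D$-models other than $\mathfrak C$ are subsets (elementary submodels) of $\mathfrak C$ of cardinality less than $\chi$. Rank. Let $A\subseteq\mathfrak C$. For a set of formulas $p(\bar x,\bar b)$ with parameters in a finite $\bar b\in A$, define $R_A[p]\ge\alpha$ by induction: $R_A[p]\ge0$ if $p$ is realized in $\mathfrak C$; for limit $\delta$, $R_A[p]\ge\delta$ if $R_A[p]\ge\alpha$ for all $\alpha<\delta$; $R_A[p]\ge\alpha+1$ if (a) there are $\bar a\in A$ and a formula $\phi(\bar x,\bar y)$ with $R_A[p\cup\{\phi(\bar x,\bar a)\}]\ge\alpha$ and $R_A[p\cup\{\neg\phi(\bar x,\bar a)\}]\ge\alpha$, and (b) for every $\bar a\in A$ there is $q(\bar x,\bar y)\in D$ with $R_A[p\cup q(\bar x,\bar a)]\ge\alpha$. $R_A[p]=-1$ if $p$ is not realized in $\mathfrak C$; $R_A[p]=\alpha$ if $R_A[p]\ge\alpha$ but not $R_A[p]\ge\alpha+1$; $R_A[p]=\infty$ if $R_A[p]\ge\alpha$ for all ordinals $\alpha$. For arbitrary $p$ over $A$, $R_A[p]=\min\{R_A[q]: q\subseteq p\restriction B,\ B\subseteq\operatorname{dom}(p)\text{ finite}\}$. $R[p]$ means $R_{\mathfrak C}[p]$. $D$ is totally transcendental if $R_A[p]<\infty$ for every $A\subseteq\mathfrak C$ and every type $p$ over $A$. A type $p$ is stationary if for every $B\supseteq\operatorname{dom}(p)$ there is a unique $p_B\in S_D(B)$ extending $p$ with $R[p_B]=R[p]$.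 Independence: $\bar a\perp_B C$ means $R[\operatorname{tp}(\bar a,B)]=R[\operatorname{tp}(\bar a,B\cup C)]$. A type $q(\bar x,\bar a)$ over a finite sequence $\bar a$ is big if for every $D$-model $M\ni\bar a$ it is realized (in $\mathfrak C$) outside $M$; $q\in S_D(A)$ is big if $q\restriction\bar a$ is big for every finite $\bar a\in A$. A big stationary $p\in S_D(A)$ is regular if for every $B\subseteq\mathfrak C$ and all $\bar a,\bar b\in p(\mathfrak C)$: if $\bar a\perp_A B$ and not $\bar b\perp_A B$, then $\bar a\perp_A (B\cup\bar b)$. For a $(D,\aleph_0)$-homogeneous model $M$, a big stationary type $q(x,\bar c)\in S_D(\bar c)$ in one variable with $\bar c\in M$ is minimal (over $M$) if it has minimal rank $R$ among all big, stationary types (complete types in one variable over subsets of $M$) over $M$. A type $q(x,\bar c)$ is called minimal if it is minimal over some $(D,\aleph_0)$-homogeneous $M\ni\bar c$. *)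

(* Defs.v *)
From mathcomp Require Import all_boot.
From mathcomp Require Import boolp classical_sets functions cardinality.

Set Implicit Arguments.
Unset Strict Implicit.
Unset Printing Implicit Defensive.

Local Open Scope classical_set_scope.

(** * First-order logic *)

Record language : Type := Language {
  fsym : Type; farity : fsym -> nat;
  rsym : Type; rarity : rsym -> nat }.

(* Terms and formulas whose free variables are elements of an arbitrary type V:
   formula L 'I_n is the type of L-formulas in x_0, ..., x_(n-1), and
   formula L ('I_n + M) is the type of such formulas with parameters in M.
   Substituting variables or parameters for variables is then renaming. *)
Inductive term (L : language) (V : Type) : Type :=
  | Var of V
  | App (f : fsym L) of ('I_(farity f) -> term L V).

Inductive formula (L : language) (V : Type) : Type :=
  | Eq of term L V & term L V
  | Rel (r : rsym L) of ('I_(rarity r) -> term L V)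
  | Bot
  | Imp of formula L V & formula L V
  | All of formula L (option V).

Definition Not L (V : Type) (phi : formula L V) : formula L V := Imp phi (Bot L V).

Fixpoint tmap L (V W : Type) (s : V -> W) (t : term L V) : term L W :=
  match t with
  | Var v => Var L (s v)
  | App f ts => App (fun i => tmap s (ts i))
  end.

Fixpoint fmap L (V W : Type) (s : V -> W) (phi : formula L V) : formula L W :=
  match phi with
  | Eq t u => Eq (tmap s t) (tmap s u)
  | Rel r ts => Rel (fun i => tmap s (ts i))
  | Bot => Bot L W
  | Imp f g => Imp (fmap s f) (fmap s g)
  | All f => All (fmap (omap s) f)
  end.

Fixpoint tfree L (V : Type) (t : term L V) : set V :=
  match t with
  | Var v => [set v]
  | App f ts => \bigcup_i tfree (ts i)
  end.

Fixpoint ffree L (V : Type) (phi : formula L V) : set V :=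
  match phi with
  | Eq t u => tfree t `|` tfree u
  | Rel r ts => \bigcup_i tfree (ts i)
  | Bot => set0
  | Imp f g => ffree f `|` ffree g
  | All f => [set v | ffree f (Some v)]
  end.

Record structure (L : language) : Type := Structure {
  carrier :> Type;
  carrier_inhabited : inhabited carrier;
  finterp : forall f : fsym L, ('I_(farity f) -> carrier) -> carrier;
  rinterp : forall r : rsym L, ('I_(rarity r) -> carrier) -> Prop }.

Fixpoint teval L (M : structure L) (V : Type) (e : V -> M) (t : term L V) : M :=
  match t with
  | Var v => e v
  | App f ts => finterp (fun i => teval e (ts i))
  end.

(* Satisfaction with quantifiers ranging over N; for N closed under the
   functions and e in N, this is satisfaction in the substructure on N. *)
Fixpoint sat_in L (M : structure L) (N : set M) (V : Type) (phi : formula L V) :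
    (V -> M) -> Prop :=
  match phi with
  | Eq t u => fun e => teval e t = teval e u
  | Rel r ts => fun e => rinterp (fun i => teval e (ts i))
  | Bot => fun=> False
  | Imp f g => fun e => sat_in N f e -> sat_in N g e
  | All f => fun e => forall x, N x -> sat_in N f (oapp e x)
  end.

Definition sat L (M : structure L) (V : Type) (phi : formula L V) (e : V -> M) : Prop :=
  sat_in [set: M] phi e.

Definition models L (M : structure L) (T : set (formula L void)) : Prop :=
  forall phi, T phi -> sat phi (of_void M).

(* D(T): the complete types over the empty set in n variables. *)
Definition types_of L (T : set (formula L void)) (n : nat) :
    set (set (formula L 'I_n)) :=
  [set q : set (formula L 'I_n) | exists (N : structure L) (c : 'I_n -> N),
     models N T /\ q = [set phi : formula L 'I_n | sat phi c]].

Definition elementary_submodel L (M : structure L) (N : set M) : Prop :=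
  [/\ N !=set0,
      (forall (f : fsym L) (xs : 'I_(farity f) -> M),
         range xs `<=` N -> N (finterp xs))
    & (forall n (phi : formula L 'I_n) (e : 'I_n -> M),
         range e `<=` N -> (sat_in N phi e <-> sat phi e))].

Definition card_lt (T U : Type) (A : set T) (B : set U) : Prop :=
  (A #<= B)%card /\ ~ (B #<= A)%card.

(** * Types with parameters in a structure *)

Section Types.
Variables (L : language) (M : structure L).

Definition pformula (n : nat) : Type := formula L ('I_n + M)%type.

Definition params n (phi : pformula n) : set M :=
  [set a : M | ffree phi (inr a)].

Definition dom n (p : set (pformula n)) : set M :=
  \bigcup_(phi in p) params phi.

Definition over_params n (A : set M) : set (pformula n) :=
  [set phi : pformula n | params phi `<=` A].

Definition restr n (p : set (pformula n)) (B : set M) : set (pformula n) :=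
  p `&` over_params B.

Definition psat n (c : 'I_n -> M) (phi : pformula n) : Prop :=
  sat phi (fun v => match v with inl i => c i | inr a => a end).

Definition realizes n (c : 'I_n -> M) (p : set (pformula n)) : Prop :=
  forall phi, p phi -> psat c phi.

Definition tp n (c : 'I_n -> M) (A : set M) : set (pformula n) :=
  [set phi : pformula n | over_params A phi /\ psat c phi].

Definition tp0 n (c : 'I_n -> M) : set (formula L 'I_n) :=
  [set phi : formula L 'I_n | sat phi c].

Definition complete_type n (A : set M) (p : set (pformula n)) : Prop :=
  [/\ p `<=` over_params A,
      (forall phi, over_params A phi -> p phi \/ p (Not phi))
    & (forall q, finite_set q -> q `<=` p -> exists c, realizes c q)].

Definition saturated : Prop :=
  forall n (A : set M) (p : set (pformula n)),
    card_lt A [set: M] -> complete_type A p -> exists c, realizes c p.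

(* q(x, a), for q(x, y) with x of length n and y of length m. *)
Definition inst n m (q : set (formula L 'I_(n + m))) (a : 'I_m -> M) :
    set (pformula n) :=
  fmap (fun i : 'I_(n + m) =>
          match fintype.split i with inl j => inl j | inr k => inr (a k) end)
    @` q.

End Types.

(** * Ordinals *)

(* Notations for ordinals: zero, successors and suprema of nonempty families.
   Every ordinal has one, in general many; ordinals enter only through the
   relation R_A[p] >= alpha, which does not depend on the choice of notation. *)
Inductive ord : Type :=
  | OZero
  | OSucc of ord
  | OSup (I : Type) (i0 : I) of (I -> ord).

(** * Finite diagrams *)

Section Diagram.
Variables (L : language) (M : structure L).
Variable D : forall n, set (set (formula L 'I_n)).

Definition D_set (A : set M) : Prop :=
  forall n (c : 'I_n -> M), range c `<=` A -> D (tp0 c).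

Definition D_model (N : set M) : Prop := elementary_submodel N /\ D_set N.

Definition S_D n (A : set M) : set (set (pformula M n)) :=
  [set p : set (pformula M n) | complete_type A p /\
     forall c, realizes c p -> D_set (A `|` range c)].

(* (D, lambda)-homogeneity, for lambda the cardinal of the set K. *)
Definition homogeneous (X : Type) (K : set X) (N : set M) : Prop :=
  D_model N /\
  forall n (A : set M) (p : set (pformula M n)),
    A `<=` N -> card_lt A K -> S_D A p ->
    exists2 c, range c `<=` N & realizes c p.

(* C is the ambient homogeneous model, and chi is the cardinal of X. *)
Variables (X : Type) (C : set M).

Definition small_D_model (N : set M) : Prop :=
  [/\ D_model N, N `<=` C & card_lt N [set: X]].

Fixpoint frank_ge (A : set M) n (p : set (pformula M n)) (alpha : ord) : Prop :=
  match alpha with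
  | OZero => exists2 c, range c `<=` C & realizes c p
  | OSucc beta =>
      (exists phi, [/\ over_params A phi, frank_ge A (p `|` [set phi]) beta
                     & frank_ge A (p `|` [set Not phi]) beta]) /\
      (forall m (a : 'I_m -> M), range a `<=` A ->
         exists2 q, @D (n + m) q & frank_ge A (p `|` inst q a) beta)
  | OSup _ _ f => forall i, frank_ge A p (f i)
  end.

(* The rank R_A[p], encoded as the predicate alpha |-> R_A[p] >= alpha: the
   predicate that never holds encodes -1, the one that always holds encodes
   infinity, the order is implication and a minimum is a conjunction.  The type
   set ord is avoided because it would force the universe of the index types in
   ord below that of pformula, and ordinals would be too short. *)
Definition rank_in (A : set M) n (p : set (pformula M n)) : ord -> Prop :=
  fun alpha => forall (B : set M) (q : set (pformula M n)),
    finite_set B -> B `<=` dom p -> q `<=` restr p B -> frank_ge A q alpha.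

Definition rank n (p : set (pformula M n)) : ord -> Prop := rank_in C p.

Definition rank_le m n (p : set (pformula M m)) (q : set (pformula M n)) :
    Prop :=
  forall alpha, rank p alpha -> rank q alpha.

Definition totally_transcendental : Prop :=
  forall (A : set M) n (p : set (pformula M n)),
    A `<=` C -> p `<=` over_params A -> exists alpha, ~ rank_in A p alpha.

(* pB is the extension p_B of p to B of the same rank. *)
Definition free_extension n (p : set (pformula M n)) (B : set M)
    (pB : set (pformula M n)) : Prop :=
  [/\ S_D B pB, p `<=` pB & rank pB = rank p].

Definition stationary n (p : set (pformula M n)) : Prop :=
  forall B, B `<=` C -> dom p `<=` B -> exists! pB, free_extension p B pB.

Definition indep n (a : 'I_n -> M) (B E : set M) : Prop :=
  rank (tp a B) = rank (tp a (B `|` E)).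

Definition big_finite n (p : set (pformula M n)) : Prop :=
  forall N, small_D_model N -> dom p `<=` N ->
    exists c, [/\ range c `<=` C, realizes c p & ~ (range c `<=` N)].

Definition big n (p : set (pformula M n)) : Prop :=
  forall F, finite_set F -> F `<=` dom p -> big_finite (restr p F).

Definition regular n (A : set M) (p : set (pformula M n)) : Prop :=
  [/\ S_D A p, big p, stationary p
    & forall (B : set M) (a b : 'I_n -> M), B `<=` C ->
        range a `<=` C -> realizes a p -> range b `<=` C -> realizes b p ->
        indep a A B -> ~ indep b A B -> indep a A (B `|` range b)].

Definition minimal_over (N : set M) k (c : 'I_k -> M) (q : set (pformula M 1)) :
    Prop :=
  [/\ range c `<=` N, S_D (range c) q, big q, stationary q
    & forall (A : set M) (r : set (pformula M 1)),
        A `<=` N -> S_D A r -> big r -> stationary r -> rank_le q r].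

Definition minimal k (c : 'I_k -> M) (q : set (pformula M 1)) : Prop :=
  exists N, [/\ small_D_model N, homogeneous [set: nat] N
              & minimal_over N c q].

End Diagram.

(* Main.v *)
(* Write R(p) = b for a type p over a finite set.  If clause (b) in the definition
   of R(p) >= b + 1 holds, then clause (a) fails, so for every tuple of parameters
   exactly one complete extension of p still has rank b.  These extensions cohere
   into a global type, and p is stationary; conversely every stationary type has a
   finite restriction of this kind with the same rank.  If N is a small
   (D, aleph_0)-homogeneous model, the type of any tuple a over N is stationary,
   because clause (b) for arbitrary parameters can be moved into N.

   Such a p with at least two realizations is big: the restriction to a model N of
   its global extension is realized, and a realization inside N would force rank 0
   and a unique realization of p.  Hence tp(a/F), F finite, is big if and only if
   a lies outside some small homogeneous model containing F.  Bigness is thus the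
   complement of a closure operator, which gives regularity once bigness and
   independence are identified.

   A big type over a small model is stationary, so a big stationary type of least
   rank exists.  If tp(a/AB) is big, choose N containing a finite F in AB with a
   outside N; a finite base of tp(a/N) can be copied into the model over which q is
   minimal, so by minimality R(tp(a/F)) >= R(q), that is, a is independent from B. *)

Require Import Defs.
From mathcomp Require Import all_boot.
From mathcomp Require Import boolp classical_sets functions cardinality.

Set Implicit Arguments.
Unset Strict Implicit.
Unset Printing Implicit Defensive.

Local Open Scope classical_set_scope.

(** * Finite sets over arbitrary types *)

Lemma finite_set_ind (T : Type) (P : set T -> Prop) :
  P set0 -> (forall x A, finite_set A -> P A -> P (x |` A)) ->
  forall A, finite_set A -> P A.
Proof.
(* Classical choice makes [T] a choice type, so that [A] can be listed as a sequence. *)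
move=> P0 PU A; elim/Pchoice: T => T in P A P0 PU *.
move=> /finite_seqP[s ->]; elim: s => [|x s IH]; first by rewrite set_nil.
rewrite (_ : [set` x :: s] = x |` [set` s]); last first.
  by apply/seteqP; split => y /=; rewrite inE; [case/predU1P|case=> [->|->]]; rewrite ?eqxx ?orbT; auto.
by apply: PU => //; exact: finite_seq.
Qed.

Lemma finite_range n (T : Type) (f : 'I_n -> T) : finite_set (range f).
Proof. by apply: finite_image; exact: finite_finset. Qed.

Lemma finite_set_enum (T : Type) (A : set T) : finite_set A ->
  exists n (f : 'I_n -> T), range f = A.
Proof.
elim/Pchoice: T => T in A *; move=> /finite_seqP[s ->].
exists (size s), (tnth (in_tuple s)); apply/seteqP; split => [_ [i _ <-]|x /=].
  exact: mem_tnth.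
by move=> /(tnthP (in_tuple s))[i ->]; exists i.
Qed.

(** * Renaming of variables *)

Section Renaming.
Variable L : language.

Lemma tmap_eq (V W : Type) (s s' : V -> W) (t : term L V) :
  (forall v, tfree t v -> s v = s' v) -> tmap s t = tmap s' t.
Proof.
elim: t => [v|f ts IH] /= h; first by rewrite h.
by congr App; apply/funext => i; apply: IH => v tv; apply: h; exists i.
Qed.

Lemma fmap_eq (V : Type) (phi : formula L V) :
  forall (W : Type) (s s' : V -> W),
  (forall v, ffree phi v -> s v = s' v) -> fmap s phi = fmap s' phi.
Proof.
elim: phi => {V} [V t u|V r ts|V|V f IHf g IHg|V f IHf] W s s' /= h.
- by congr Eq; apply: tmap_eq => v tv; apply: h; [left|right].
- by congr Rel; apply/funext => i; apply: tmap_eq => v tv; apply: h; exists i.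
- by [].
- by congr Imp; [apply: IHf|apply: IHg] => v tv; apply: h; [left|right].
- by congr All; apply: IHf => -[v|] //= tv; rewrite h.
Qed.

Lemma tmap_id (V : Type) (t : term L V) : tmap id t = t.
Proof. by elim: t => //= f ts IH; congr App; apply/funext. Qed.

Lemma fmap_id (V : Type) (phi : formula L V) : fmap id phi = phi.
Proof.
elim: phi => {V} [V t u|V r ts|V|V f IHf g IHg|V f IHf] //=.
- by rewrite !tmap_id.
- by congr Rel; apply/funext => i; rewrite tmap_id.
- by rewrite IHf IHg.
- by congr All; rewrite -[RHS]IHf; apply: fmap_eq => -[].
Qed.

Lemma tmap_comp (U V W : Type) (s : V -> W) (s' : U -> V) (t : term L U) :
  tmap s (tmap s' t) = tmap (s \o s') t.
Proof. by elim: t => //= f ts IH; congr App; apply/funext. Qed.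

Lemma fmap_comp (U : Type) (phi : formula L U) :
  forall (V W : Type) (s : V -> W) (s' : U -> V),
  fmap s (fmap s' phi) = fmap (s \o s') phi.
Proof.
elim: phi => {U} [U t u|U r ts|U|U f IHf g IHg|U f IHf] V W s s' //=.
- by rewrite !tmap_comp.
- by congr Rel; apply/funext => i; rewrite tmap_comp.
- by rewrite IHf IHg.
- by congr All; rewrite IHf; apply: fmap_eq => -[].
Qed.

Lemma tfree_tmap (V W : Type) (s : V -> W) (t : term L V) :
  tfree (tmap s t) = s @` tfree t.
Proof.
elim: t => [v|f ts IH] /=; first by rewrite image_set1.
rewrite image_bigcup; apply: eq_bigcupr => i _; exact: IH.
Qed.

Lemma ffree_fmap (V : Type) (phi : formula L V) :
  forall (W : Type) (s : V -> W), ffree (fmap s phi) = s @` ffree phi.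
Proof.
elim: phi => {V} [V t u|V r ts|V|V f IHf g IHg|V f IHf] W s /=.
- by rewrite !tfree_tmap image_setU.
- by rewrite image_bigcup; apply: eq_bigcupr => i _; rewrite tfree_tmap.
- by rewrite image_set0.
- by rewrite IHf IHg image_setU.
- rewrite IHf; apply/seteqP; split => [w [[v|] //= fv [<-]]|w [v fv <-]] /=.
    by exists v.
  by exists (Some v).
Qed.

Lemma finite_tfree (V : Type) (t : term L V) : finite_set (tfree t).
Proof.
elim: t => [v|f ts IH] /=; first exact: finite_set1.
by apply: bigcup_finite => //; exact: finite_finset.
Qed.

Lemma finite_ffree (V : Type) (phi : formula L V) : finite_set (ffree phi).
Proof.
elim: phi => {V} [V t u|V r ts|V|V f IHf g IHg|V f IHf] /=.
- by rewrite finite_setU; split; exact: finite_tfree.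
- apply: bigcup_finite; first exact: finite_finset.
  by move=> i _; exact: finite_tfree.
- exact: finite_set0.
- by rewrite finite_setU.
- by apply: (@finite_preimage _ _ (ffree f) Some) => // ? ? _ _ [].
Qed.

Variable M : structure L.

Lemma teval_tmap (V W : Type) (s : V -> W) (e : W -> M) (t : term L V) :
  teval e (tmap s t) = teval (e \o s) t.
Proof. by elim: t => //= f ts IH; congr finterp; apply/funext. Qed.

Lemma sat_in_fmap (N : set M) (V : Type) (phi : formula L V) :
  forall (W : Type) (s : V -> W) (e : W -> M),
  sat_in N (fmap s phi) e = sat_in N phi (e \o s).
Proof.
elim: phi => {V} [V t u|V r ts|V|V f IHf g IHg|V f IHf] W s e //=.
- by rewrite !teval_tmap.
- by congr rinterp; apply/funext => i; rewrite teval_tmap.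
- by rewrite IHf IHg.
- apply: eq_forall => x; rewrite IHf; congr (_ -> sat_in _ _ _).
  by apply/funext => -[].
Qed.

Lemma sat_fmap (V W : Type) (phi : formula L V) (s : V -> W) (e : W -> M) :
  sat (fmap s phi) e = sat phi (e \o s).
Proof. exact: sat_in_fmap. Qed.

Lemma teval_eq (V : Type) (e e' : V -> M) (t : term L V) :
  (forall v, tfree t v -> e v = e' v) -> teval e t = teval e' t.
Proof.
elim: t => [v|f ts IH] /= h; first by rewrite h.
by congr finterp; apply/funext => i; apply: IH => v tv; apply: h; exists i.
Qed.

Lemma sat_in_eq (N : set M) (V : Type) (phi : formula L V) :
  forall e e' : V -> M, (forall v, ffree phi v -> e v = e' v) ->
  sat_in N phi e = sat_in N phi e'.
Proof.
elim: phi => {V} [V t u|V r ts|V|V f IHf g IHg|V f IHf] e e' /= h.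
- by rewrite (@teval_eq _ e e') ?(@teval_eq _ e e' u) // => v tv; apply: h; [right|left].
- by congr rinterp; apply/funext => i; apply: teval_eq => v tv; apply: h; exists i.
- by [].
- by rewrite (IHf e e') ?(IHg e e') // => v tv; apply: h; [right|left].
- by apply: eq_forall => x; rewrite (IHf _ (oapp e' x)) // => -[v|] //=; exact: h.
Qed.

Lemma sat_eq (V : Type) (phi : formula L V) (e e' : V -> M) :
  (forall v, ffree phi v -> e v = e' v) -> sat phi e = sat phi e'.
Proof. exact: sat_in_eq. Qed.

End Renaming.

(** * Elementary maps and homogeneity *)

Section ElementaryRelation.
Variables (L : language) (M : structure L).

Definition assign n (V W : Type) (c : 'I_n -> W) (f : V -> W) (v : 'I_n + V) : W :=
  match v with inl i => c i | inr x => f x end.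

Definition param_map n (V W : Type) (f : V -> W) (v : 'I_n + V) : 'I_n + W :=
  match v with inl i => inl i | inr x => inr (f x) end.

Lemma psat_param_map n (V : Type) (c : 'I_n -> M) (f : V -> M)
    (phi : formula L ('I_n + V)) :
  psat c (fmap (param_map f) phi) = sat phi (assign c f).
Proof. by rewrite /psat sat_fmap; congr sat; apply/funext => -[]. Qed.

Lemma psatE n (c : 'I_n -> M) (phi : pformula M n) :
  psat c phi = sat phi (assign c id).
Proof. by congr sat; apply/funext => -[]. Qed.

Lemma params_param_map n (V : Type) (f : V -> M) (phi : formula L ('I_n + V)) :
  params (fmap (param_map f) phi) = f @` [set x | ffree phi (inr x)].
Proof.
apply/seteqP; split => x; rewrite /params /= ffree_fmap /=.
  by move=> [[i|y] //= fy [<-]]; exists y.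
by move=> [y fy <-]; exists (inr y).
Qed.

(* A set of pairs viewed as a partial elementary map; it is automatically
   functional and injective, because equations between parameters are
   preserved and reflected.  A formula whose parameters are pairs in [G] stands
   both for a formula (through [fst]) and for its image under [G] (through
   [snd]). *)
Definition elementary (G : set (M * M)) : Prop :=
  forall phi : formula L (M * M), ffree phi `<=` G -> sat phi fst -> sat phi snd.

Definition converse (G : set (M * M)) : set (M * M) := [set p | G (p.2, p.1)].

Definition diag_on (A : set M) : set (M * M) := [set p | A p.1 /\ p.2 = p.1].

(** Preservation applied to the negation of [phi] is reflection of [phi]. *)
Lemma elementary_iff G (phi : formula L (M * M)) :
  elementary G -> ffree phi `<=` G -> (sat phi fst <-> sat phi snd).
Proof.
move=> eG phiG; split; first exact: eG.
move=> h; apply: contrapT => nh.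
suff /(_ h) : sat (Not phi) snd by [].
by apply: eG => // v [/phiG|].
Qed.

Lemma elementary_sub G H : G `<=` H -> elementary H -> elementary G.
Proof. by move=> GH eH phi phiG; apply: eH; exact: subset_trans GH. Qed.

Lemma elementary_converse G : elementary G -> elementary (converse G).
Proof.
move=> eG phi phiG.
pose s (p : M * M) := (p.2, p.1).
have [|_] := elementary_iff (phi := fmap s phi) eG.
  by rewrite ffree_fmap => _ [v /phiG fv <-].
by rewrite !sat_fmap.
Qed.

Lemma converseK G : converse (converse G) = G.
Proof. by apply/seteqP; split => -[]. Qed.

Lemma elementary_diagonal A : elementary (diag_on A).
Proof. by move=> phi phiA; rewrite (sat_eq (e' := snd)) // => v /phiA[]. Qed.

Lemma elementary_set0 : elementary (set0 : set (M * M)).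
Proof. by move=> phi phi0; rewrite (sat_eq (e' := snd)) // => v /phi0. Qed.

(** With a middle point [m p] chosen for every parameter [p] of [phi], truth is carried along [G]
    after renaming [p] to [(p.1, m p)] and along [H] after renaming it to [(m p, p.2)]. *)
Lemma elementary_comp G H :
  elementary G -> elementary H ->
  elementary [set p | exists2 y, G (p.1, y) & H (y, p.2)].
Proof.
move=> eG eH phi phiGH.
have /choice[m mP] : forall p : M * M, exists y, ffree phi p -> G (p.1, y) /\ H (y, p.2).
  move=> p; have [/phiGH[y Gy Hy]|nf] := EM (ffree phi p); first by exists y.
  by exists p.1.
have h1 : sat (fmap (fun p => (p.1, m p)) phi) fst -> sat (fmap (fun p => (p.1, m p)) phi) snd.
  by apply: eG; rewrite ffree_fmap => _ [p /mP[? _] <-].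
have h2 : sat (fmap (fun p => (m p, p.2)) phi) fst -> sat (fmap (fun p => (m p, p.2)) phi) snd.
  by apply: eH; rewrite ffree_fmap => _ [p /mP[_ ?] <-].
by rewrite !sat_fmap in h1 h2 => /h1/h2.
Qed.

Lemma elementary_inj G x x' y y' :
  elementary G -> G (x, y) -> G (x', y') -> (x = x' <-> y = y').
Proof.
move=> eG Gxy Gxy'.
have := elementary_iff (phi := Eq (Var L (x, y)) (Var L (x', y'))) eG; apply.
by move=> v /= [->|->].
Qed.

(** This links maps with types: the pairs [(c i, d i)] act as variables and [G] supplies the
    parameters. *)
Lemma elementary_types n (G : set (M * M)) (c d : 'I_n -> M) :
  elementary (G `|` range (fun i => (c i, d i))) <->
  (forall phi : formula L ('I_n + M * M),
     (forall p, ffree phi (inr p) -> G p) ->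
     sat phi (assign c fst) -> sat phi (assign d snd)).
Proof.
split=> [eG phi phiG|h phi phiG].
  pose s := assign (fun i => (c i, d i)) (@id (M * M)).
  have := eG (fmap s phi); rewrite !sat_fmap ffree_fmap.
  have -> : fst \o s = assign c fst by apply/funext => -[].
  have -> : snd \o s = assign d snd by apply/funext => -[].
  by apply=> _ [[i|p] fv <-]; [right; exists i|left; exact: phiG].
(* A pair in the range becomes a variable even if it also lies in [G]; only the other pairs stay
   parameters. *)
have /choice[s sP] : forall p, exists v : 'I_n + M * M,
    assign (fun i => (c i, d i)) id v = p /\ ((exists i, v = inl i) \/
      v = inr p /\ ~ range (fun i => (c i, d i)) p).
  move=> p; have [[i _ <-]|nr] := EM (range (fun i => (c i, d i)) p).
    by exists (inl i); split => //; left; exists i.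
  by exists (inr p); split => //; right.
have := h (fmap s phi); rewrite !sat_fmap.
have -> : assign c fst \o s = fst.
  by apply/funext => p /=; have [e _] := sP p; rewrite -[in RHS]e; case: (s p).
have -> : assign d snd \o s = snd.
  by apply/funext => p /=; have [e _] := sP p; rewrite -[in RHS]e; case: (s p).
apply=> p; rewrite ffree_fmap => -[v fv svp].
have [_ [[i]|[]]] := sP v; rewrite svp // => -[->] nr.
by have [|] := phiG _ fv.
Qed.

Lemma elementary_tp0 n (G : set (M * M)) (c d : 'I_n -> M) :
  elementary G -> (forall i, G (c i, d i)) -> tp0 c = tp0 d.
Proof.
move=> eG cdG; apply/seteqP; split => phi; rewrite /tp0 /=;
  (have [|h1 h2] := elementary_iff (phi := fmap (fun i => (c i, d i)) phi) eG;
    first by rewrite ffree_fmap => _ [i _ <-]; exact: cdG);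
  by move: h1 h2; rewrite !sat_fmap.
Qed.

Variable D : forall n, set (set (formula L 'I_n)).

Lemma D_set_elementary G : elementary G ->
  D_set D (fst @` G) -> D_set D (snd @` G).
Proof.
move=> eG DG n d dG.
have /choice[c cG] : forall i, exists x, G (x, d i).
  by move=> i; have [[x y] Gxy <-] := dG (d i) (imageT _ _); exists x.
rewrite -(elementary_tp0 eG cG); apply: DG => _ [i _ <-].
by exists (c i, d i).
Qed.

Lemma D_set_sub (A B : set M) : A `<=` B -> D_set D B -> D_set D A.
Proof. by move=> AB DB n c cA; apply: DB; exact: subset_trans AB. Qed.

Lemma tp_complete n (A : set M) (c : 'I_n -> M) : complete_type A (tp c A).
Proof.
split=> [phi []//|phi phiA|q _ qtp]; last by exists c => phi /qtp[].
have [h|h] := EM (psat c phi); first by left.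
by right; split => // x [/phiA|].
Qed.

(** The image under [G] of the type of [a] over the domain is a type in [S_D] over the range, and a
    realization of it in [N] may serve as the value at [a]. *)
Lemma homogeneous_extend1 (Y : Type) (K : set Y) (N : set M) G a :
  homogeneous D K N -> elementary G -> D_set D (a |` fst @` G) ->
  snd @` G `<=` N -> card_lt (snd @` G) K ->
  exists2 b, N b & elementary (G `|` [set (a, b)]).
Proof.
move=> [_ homN] eG Da GN GK.
pose a1 (_ : 'I_1) := a.
pose p := fmap (@param_map 1 _ _ snd) @`
  [set phi : formula L ('I_1 + M * M) | (forall p, ffree phi (inr p) -> G p) /\
     sat phi (assign a1 fst)].
have pG c : realizes c p -> elementary (G `|` range (fun i => (a1 i, c i))).
  move=> cp; apply/elementary_types => phi phiG sphi.
  by rewrite -psat_param_map; apply: cp; exists phi.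
have pS : S_D D (snd @` G) p.
  split; last first.
    move=> c /pG/D_set_elementary h.
    have : D_set D (snd @` (G `|` range (fun i => (a1 i, c i)))).
      apply: h; apply: D_set_sub Da => _ [r [Gr|[i _ <-]] <-]; last by left.
      by right; exists r.
    apply: D_set_sub => x [[r Gr <-]|[i _ <-]]; first by exists r => //; left.
    by exists (a1 i, c i) => //; right; exists i.
  split.
  - by move=> _ [phi [phiG _] <-]; rewrite /over_params /= params_param_map => _ [x /phiG ? <-]; exists x.
  - move=> phi phiG.
    have /choice[g gP] : forall y, exists x : M * M, params phi y -> G x /\ x.2 = y.
      move=> y; have [/phiG[x Gx <-]|nf] := EM (params phi y); first by exists x.
      by exists (y, y).
    have phiE : phi = fmap (param_map snd) (fmap (param_map g) phi).
      rewrite fmap_comp -[LHS]fmap_id; apply: fmap_eq => -[i|y] //= fy.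
      by rewrite (gP y fy).2.
    have gG q : ffree (fmap (@param_map 1 _ _ g) phi) (inr q) -> G q.
      by rewrite ffree_fmap => -[[i|y] //= fy [<-]]; exact: (gP y fy).1.
    have [h|h] := EM (sat (fmap (@param_map 1 _ _ g) phi) (assign a1 fst)).
      by left; rewrite phiE; exists (fmap (@param_map 1 _ _ g) phi).
    right; rewrite phiE; exists (Not (fmap (@param_map 1 _ _ g) phi)) => //.
    by split => // q [/gG|].
  move=> q fq qp.
  (* [psi] is the conjunction of formulas whose images make up the finite set [q]. *)
  have [psi [psiG spsi psiq]] : exists psi : formula L ('I_1 + M * M),
      [/\ forall p, ffree psi (inr p) -> G p, sat psi (assign a1 fst) &
        forall c, sat psi (assign c snd) -> realizes c q].
    move: q fq qp; apply: finite_set_ind => [_|phi q _ IH qp].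
      exists (Not (Bot L _)); split => //; first by move=> p0 [].
      by move=> c _ phi.
    have [|psi [psiG spsi psiq]] := IH; first by move=> ? ?; apply: qp; right.
    have [phi' [phiG sphi] phiE] := qp phi (or_introl erefl).
    exists (Not (Imp psi (Not phi'))); split=> [r [[/psiG|[/phiG|]]|]||c h] //=.
      by move=> /(_ spsi sphi).
    have [c1 c2] : sat psi (assign c snd) /\ sat phi' (assign c snd).
      by split; apply: contrapT => nh; apply: h => // ? /nh.
    by move=> _ [->|/(psiq c c1)//]; rewrite -phiE psat_param_map.
  pose s (v : 'I_1 + M * M) := match v with inl _ => None | inr x => Some x end.
  have sE (f : M * M -> M) x : sat_in [set: M] (fmap s psi) (oapp f x) = sat psi (assign (fun=> x) f).
    by rewrite sat_in_fmap; congr sat_in; apply/funext => -[].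
  (* The existential closure of [psi] holds on the [fst] side with witness [a], hence on the [snd]
     side, where a witness realizes [q]. *)
  have exG : ffree (Not (All (Not (fmap s psi)))) `<=` G.
    by move=> x /= [[|//]|//]; rewrite ffree_fmap => -[[i|y] //= /psiG ? [<-]].
  have h := eG _ exG.
  apply: contrapT => nh; apply: h => [h|x _ hx].
    have h2 : sat_in [set: M] (fmap s psi) (oapp fst a) by rewrite sE.
    exact: (h a I h2).
  by apply: nh; exists (fun=> x); apply: psiq; rewrite -sE.
have [b bN bp] := homN _ _ _ GN GK pS.
exists (b ord0); first by apply: bN; exists ord0.
apply: elementary_sub (pG b bp) => x [|->]; [by left|right].
by exists ord0.
Qed.

End ElementaryRelation.

(** * Sets smaller than an infinite set *)

Lemma finite_card_lt (T U : Type) (F : set T) (K : set U) :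
  infinite_set K -> finite_set F -> card_lt F K.
Proof.
move=> iK fF; split; last first.
  by move=> KF; apply: iK; exact: card_le_finite KF fF.
have /finite_set_leP[n Fn] := fF.
have /infiniteP nK := iK.
exact: card_le_trans Fn (card_le_trans (subset_card_le (@subsetT _ _)) nK).
Qed.

Lemma card_lt_le (T U V : Type) (A : set T) (B : set U) (K : set V) :
  (A #<= B)%card -> card_lt B K -> card_lt A K.
Proof.
move=> AB [BK nKB]; split; first exact: card_le_trans BK.
by move=> KA; apply: nKB; exact: card_le_trans AB.
Qed.

(** Hilbert's hotel: for an injective sequence [f] in [A], the map [g] sends [x] to [f 0] and [f n]
    to [f n.+1], and fixes the other points. *)
Lemma card_infinite_setU1 (T : Type) (x : T) (A : set T) :
  infinite_set A -> (x |` A #<= A)%card.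
Proof.
elim/Ppointed: T => T in x A *; first by case: (no x).
have [Ax _|nAx] := EM (A x).
  by apply: subset_card_le => y [->|].
move=> /infiniteP/pcard_leP[f].
have fA n : A (f n) by apply: funS.
have finj m n : f m = f n -> m = n by apply: (inj (f := f)); rewrite inE.
have /choice[g gP] : forall y, exists z, [\/ y = x /\ z = f 0,
    y <> x /\ (exists2 n, y = f n & z = f n.+1) |
    [/\ y <> x, z = y & forall n, y <> f n]].
  move=> y; have [yx|yx] := EM (y = x); first by exists (f 0); apply: Or31.
  have [[n yn]|yn] := EM (exists n, y = f n).
    by exists (f n.+1); apply: Or32; split => //; exists n.
  by exists y; apply: Or33; split => // n yfn; apply: yn; exists n.
have gA : g @` (x |` A) `<=` A.
  by move=> _ [y yA <-]; have [[_ ->]|[_ [n _ ->]]|[yx -> _]] := gP y => //; case: yA.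
apply: card_le_trans (subset_card_le gA).
suff /inj_card_eq : {in x |` A &, injective g} by rewrite card_eq_le => /andP[].
move=> y z _ _; have [[-> ->]|[yx [n -> ->]]|[yx -> yf]] := gP y;
  have [[-> ->]|[zx [m -> ->]]|[zx -> zf]] := gP z => //.
- by move/finj.
- by move=> h; case: (zf 0).
- by move/finj.
- by move=> /finj[->].
- by move=> h; case: (zf n.+1).
- by move=> h; case: (yf 0).
- by move=> h; case: (yf m.+1).
Qed.

Lemma card_lt_setU_finite (T U : Type) (A F : set T) (K : set U) :
  infinite_set K -> finite_set F -> card_lt A K -> card_lt (F `|` A) K.
Proof.
move=> iK fF AK; move: F fF; apply: finite_set_ind; first by rewrite set0U.
move=> x F fF IH; have [fFA|iFA] := EM (finite_set (F `|` A)).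
  apply: finite_card_lt => //; rewrite -setUA finite_setU; split => //.
by rewrite -setUA; apply: card_lt_le IH; exact: card_infinite_setU1.
Qed.

(** * Extending elementary maps *)

Section Extension.
Variables (L : language) (M : structure L).
Variable D : forall n, set (set (formula L 'I_n)).

(** Zorn's lemma gives a maximal [H] that can be added to [G] with domain in [E]; a point of [E]
    still missed could be added by [homogeneous_extend1]. *)
Lemma homogeneous_extend (Y : Type) (K : set Y) (N : set M) G E :
  homogeneous D K N -> elementary G -> D_set D (fst @` G `|` E) ->
  snd @` G `<=` N -> card_lt (fst @` G `|` E) K ->
  exists H, [/\ G `<=` H, elementary H, snd @` H `<=` N & fst @` H = fst @` G `|` E].
Proof.
move=> homN eG DG GN GK.
pose P H := [/\ elementary (G `|` H), fst @` H `<=` E & snd @` H `<=` N].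
have [F FP totF|H [[eGH HE HN] Hmax]] := @Zorn_bigcup _ P.
  split; first last.
  - by move=> _ [p [H FH Hp] <-]; have [_ _] := FP _ FH; apply; exists p.
  - by move=> _ [p [H FH Hp] <-]; have [_ + _] := FP _ FH; apply; exists p.
  move=> phi phiF.
  suff [H eH phiH] : exists2 H, elementary H & ffree phi `<=` H by apply: eH.
  (* The finitely many parameters outside [G] lie in a single member of the chain; [set0] covers the
     case that no member has been chosen. *)
  suff [H eH phiH] : exists2 H, F H \/ H = set0 & ffree phi `<=` G `|` H.
    by exists (G `|` H) => //; case: eH => [/FP[]//|->]; rewrite setU0.
  move: (ffree phi) (finite_ffree phi) phiF.
  apply: finite_set_ind => [_|p Q _ IH QF].
    by exists set0; [right|move=> ?].
  have [|H FH QH] := IH; first by move=> q Qq; apply: QF; right.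
  have [|Gp|[H' FH' Hp]] := QF p; first by left.
    by exists H => // q [->|/QH//]; left.
  case: FH => [FH|H0]; last first.
    exists H'; first by left.
    by move=> q [->|/QH]; [right|rewrite H0 => -[]; left].
  have [HH'|H'H] := totF _ _ FH FH'.
    exists H'; first by left.
    by move=> q [->|/QH[]]; [right|left|right; exact: HH'].
  exists H; first by left.
  by move=> q [->|/QH//]; right; exact: H'H.
have GHE : fst @` (G `|` H) `<=` fst @` G `|` E.
  by rewrite image_setU; exact: setUS.
exists (G `|` H); split => //; first by rewrite image_setU subUset; split.
apply/seteqP; split => // x [Gx|Ex]; first by rewrite image_setU; left.
apply: contrapT => nx.
have [|||b Nb eb] := @homogeneous_extend1 _ _ D _ _ _ (G `|` H) x homN eGH.
- by apply: D_set_sub DG => y [->|/GHE//]; right.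
- by rewrite image_setU subUset; split.
(* An elementary map is functional, so its range is no larger than its domain. *)
- apply: card_lt_le GK; apply: card_le_trans (subset_card_le GHE).
  have /choice[h hP] : forall u, exists v, (fst @` (G `|` H)) u -> (G `|` H) (u, v).
    move=> u; have [[[u' v] uv /= <-]|nu] := EM ((fst @` (G `|` H)) u).
      by exists v.
    by exists u.
  apply: card_le_trans (card_image_le h _); apply: subset_card_le.
  move=> _ [[u v] uv <-] /=; exists u; first by exists (u, v).
  have huv : (G `|` H) (u, h u) by apply: hP; exists (u, v).
  exact: (elementary_inj eGH huv uv).1.
have := Hmax (H `|` [set (x, b)]); apply.
  split; first by left.
  by move=> h; apply: nx; exists (x, b) => //; right; apply: h; right.
rewrite /P setUA; split => //.
  by rewrite image_setU subUset; split => // _ [_ -> <-].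
by rewrite image_setU subUset; split => // _ [_ -> <-].
Qed.

(** [G] is an isomorphism from its domain to its range, so satisfaction relative to these sets
    corresponds ([isoG]), and satisfaction in [M] corresponds by elementarity. *)
Lemma elementary_submodel_image (G : set (M * M)) : elementary G ->
  elementary_submodel (fst @` G) -> elementary_submodel (snd @` G).
Proof.
move=> eG [[_ [p Gp _]] cG sG]; split; first by exists p.2, p.
  move=> f xs xsG.
  have /choice[ys ysG] : forall i, exists y, G (y, xs i).
    by move=> i; have [[y x] Gyx <-] := xsG (xs i) (imageT _ _); exists y.
  have [|[y z] Gyz /= yE] := cG f ys.
    by move=> _ [i _ <-]; exists (ys i, xs i).
  exists (y, z) => //=.
  have [|h _] := elementary_iff
     (phi := Eq (App (fun i => Var L (ys i, xs i))) (Var L (y, z))) eG.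
    by move=> q /= [[i _ ->]|->].
  exact: esym (h (esym yE)).
have isoG (V : Type) (phi : formula L V) : forall e : V -> M * M, (forall v, G (e v)) ->
    sat_in (fst @` G) phi (fst \o e) <-> sat_in (snd @` G) phi (snd \o e).
  elim: phi => {}V.
  - move=> t u e Ge; have [|] := elementary_iff (phi := fmap e (Eq t u)) eG.
      by rewrite ffree_fmap => _ [v _ <-].
    by rewrite !sat_fmap.
  - move=> r ts e Ge; have [|] := elementary_iff (phi := fmap e (Rel ts)) eG.
      by rewrite ffree_fmap => _ [v _ <-].
    by rewrite !sat_fmap.
  - by [].
  - move=> f IHf g IHg e Ge /=.
    by have [? ?] := IHf e Ge; have [? ?] := IHg e Ge; split; tauto.
  - move=> f IHf e Ge /=.
    have he q : G q -> (sat_in (fst @` G) f (oapp (fst \o e) q.1) <->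
        sat_in (snd @` G) f (oapp (snd \o e) q.2)).
      move=> Gq; have := IHf (oapp e q).
      have -> : fst \o oapp e q = oapp (fst \o e) q.1 by apply/funext => -[].
      have -> : snd \o oapp e q = oapp (snd \o e) q.2 by apply/funext => -[].
      by apply=> -[v|] /=.
    split=> h _ [q Gq <-].
      by apply/(he q Gq); apply: h; exists q.
    by apply/(he q Gq); apply: h; exists q.
move=> n phi e eGr.
have /choice[e' e'G] : forall i, exists q, G q /\ q.2 = e i.
  by move=> i; have [q Gq <-] := eGr (e i) (imageT _ _); exists q.
have eE : e = snd \o e' by apply/funext => i /=; rewrite (e'G i).2.
rewrite eE; rewrite -isoG; last by move=> i; exact: (e'G i).1.
rewrite sG; last by move=> _ [i _ <-]; exists (e' i) => //; exact: (e'G i).1.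
have [|] := elementary_iff (phi := fmap e' phi) eG.
  by rewrite ffree_fmap => _ [i _ <-]; exact: (e'G i).1.
by rewrite !sat_fmap.
Qed.

(* The consequence of (D, aleph_0)-homogeneity that is used below; unlike
   homogeneity, it visibly passes to images under elementary maps. *)
Definition extensible (C N : set M) : Prop := forall G a,
  finite_set G -> elementary G -> fst @` G `<=` C -> snd @` G `<=` N -> C a ->
  exists2 b, N b & elementary (G `|` [set (a, b)]).

Lemma homogeneous_extensible (Y : Type) (K : set Y) (C N : set M) :
  infinite_set K -> D_set D C -> homogeneous D K N -> extensible C N.
Proof.
move=> iK DC homN G a fG eG GC GN Ca; apply: homogeneous_extend1 homN eG _ GN _.
  by apply: D_set_sub DC => x [->|/GC].
by apply: finite_card_lt => //; exact: finite_image.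
Qed.

Lemma extensible_finite (C N : set M) G E : extensible C N ->
  finite_set G -> elementary G -> fst @` G `<=` C -> snd @` G `<=` N ->
  finite_set E -> E `<=` C ->
  exists H, [/\ G `<=` H, finite_set H, elementary H, fst @` H = fst @` G `|` E & snd @` H `<=` N].
Proof.
move=> extN fG eG GC GN fE; move: E fE.
apply: finite_set_ind => [_|a E fE IH EC].
  by exists G; rewrite setU0; split => //; exact: subset_refl.
have [|H [GH fH eH HE HN]] := IH; first by move=> x Ex; apply: EC; right.
have [|b Nb eb] := extN H a fH eH _ HN (EC _ (or_introl erefl)).
  by rewrite HE subUset; split => // x Ex; apply: EC; right.
exists (H `|` [set (a, b)]); split => //.
- by move=> x Gx; left; exact: GH.
- by rewrite finite_setU; split => //; exact: finite_set1.
- by rewrite image_setU HE image_set1 /= -setUA [E `|` _]setUC.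
- by rewrite image_setU subUset; split => // _ [_ -> <-].
Qed.

Lemma extensible_tuple (C N : set M) G n (c : 'I_n -> M) : extensible C N ->
  finite_set G -> elementary G -> fst @` G `<=` C -> snd @` G `<=` N ->
  range c `<=` C ->
  exists2 d, range d `<=` N & elementary (G `|` range (fun i : 'I_n => (c i, d i))).
Proof.
move=> extN fG eG GC GN cC.
have [H [GH fH eH HE HN]] := extensible_finite extN fG eG GC GN (finite_range c) cC.
have /choice[d dH] : forall i, exists y, H (c i, y).
  move=> i; have : (fst @` H) (c i) by rewrite HE; right; exists i.
  by move=> [[x y] Hxy /= <-]; exists y.
exists d; first by move=> _ [i _ <-]; apply: HN; exists (c i, d i).
by apply: elementary_sub eH => p [/GH//|[i _ <-]].
Qed.

End Extension.

(** * Images of small models *)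

Section Embedding.
Variables (L : language) (M : structure L).
Variable D : forall n, set (set (formula L 'I_n)).
Variables (X : Type) (C : set M).
Hypothesis infX : infinite_set [set: X].
Hypothesis homC : homogeneous D [set: X] C.

Definition small_extensible (N : set M) : Prop :=
  small_D_model D X C N /\ extensible C N.

Lemma extensible_ambient : extensible C C.
Proof. by apply: homogeneous_extensible homC => //; case: homC => -[]. Qed.

(** Homogeneity of [C] extends [G] to all of [N]. The image of [N] is again extensible: a finite map
    into it is pulled back to [N], extended there and pushed forward. *)
Lemma small_extensible_image (N : set M) G : small_extensible N ->
  finite_set G -> elementary G -> fst @` G `<=` C -> snd @` G `<=` C ->
  exists H, [/\ G `<=` H, elementary H, fst @` H = fst @` G `|` N, snd @` H `<=` C
    & small_extensible [set y | exists2 x, N x & H (x, y)]].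
Proof.
move=> [[[subN DN] NC Nsm] extN] fG eG GC GC'.
have DC : D_set D C by case: homC => -[].
have [||H [GH eH HC HE]] := homogeneous_extend (E := N) homC eG _ GC'.
- by apply: D_set_sub DC => x [/GC|/NC].
- by apply: card_lt_setU_finite => //; exact: finite_image.
exists H; split => //.
pose H' := H `&` [set p | N p.1].
have eH' : elementary H' by apply: elementary_sub eH => p [].
have H'1 : fst @` H' = N.
  apply/seteqP; split => [_ [p [_ Np] <-]//|x Nx].
  have : (fst @` H) x by rewrite HE; right.
  by move=> [p Hp px]; exists p => //; split => //=; rewrite px.
have -> : [set y | exists2 x, N x & H (x, y)] = snd @` H'.
  apply/seteqP; split => [y [x Nx Hxy]|_ [[x y] [Hxy /= Nx] <-]].
    by exists (x, y).
  by exists x.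
split; first split.
- split; first by apply: elementary_submodel_image => //; rewrite H'1.
  by apply: D_set_elementary => //; rewrite H'1.
- by move=> _ [p [Hp _] <-]; apply: HC; exists p.
- have /choice[h hP] : forall u, exists v, N u -> H' (u, v).
    move=> u; have [|nu] := EM (N u); last by exists u.
    by rewrite -H'1 => -[[u' v] uv /= <-]; exists v.
  apply: card_lt_le Nsm; apply: card_le_trans (card_image_le h _).
  apply: subset_card_le => _ [[u v] uv <-] /=; exists u; first by case: uv.
  exact: (elementary_inj eH' (hP _ uv.2) uv).1.
- move=> F a fF eF FC FH' Ca.
  pose F' := [set p | exists2 y, F (p.1, y) & H' (p.2, y)].
  have eF' : elementary F'.
    have := elementary_comp eF (elementary_converse eH').
    by apply: elementary_sub => p [y]; exists y.
  have /choice[h hP] : forall p, exists x, F p -> H' (x, p.2).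
    move=> p; have [Fp|nF] := EM (F p); last by exists p.1.
    by have [[x y] ? <-] := FH' p.2 (ex_intro2 _ _ p Fp erefl); exists x.
  have fF' : finite_set F'.
    apply: sub_finite_set (finite_image (fun p => (p.1, h p)) fF).
    move=> [u v] /= [y Fuy Hvy]; exists (u, y) => //=; congr pair.
    by rewrite -(elementary_inj eH' Hvy (hP _ Fuy)).2.
  have [||b Nb eb] := extN F' a fF' eF' _ _ Ca.
  + by move=> _ [p [y Fp _] <-]; apply: FC; exists (p.1, y).
  + by move=> _ [p [y _ [_ Np]] <-].
  rewrite -H'1 in Nb; case: Nb => -[b' c] Hbc /= bE; rewrite {}bE in Hbc.
  exists c; first by exists (b, c).
  apply: elementary_sub (elementary_comp eb eH') => -[u v] /= [Fuv|[-> ->]]; last first.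
    by exists b => //; right.
  have Hh : H' (h (u, v), v) by exact: hP (u, v) Fuv.
  by exists (h (u, v)) => //; left; exists v.
Qed.

End Embedding.

(** * Ordinals and the rank *)

(** For [OSucc a'] the inner recursion is the strict comparison of [a'] with [b]: a supremum exceeds
    [a'] as soon as one of its terms does. *)
Fixpoint ord_le (a : ord) : ord -> Prop :=
  match a with
  | OZero => fun=> True
  | OSucc a' => fix ord_lt b := match b with
      | OZero => False
      | OSucc b' => ord_le a' b'
      | OSup _ _ f => exists i, ord_lt (f i)
      end
  | OSup _ _ f => fun b => forall i, ord_le (f i) b
  end.

Lemma ord_le_total a b : ord_le a b \/ ord_le (OSucc b) a.
Proof.
elim: a b => [b|a IH|I i0 f IH] /=; first by left.
  elim=> [|b _|I i0 f IHf]; [by right|exact: IH|].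
  have [h|h] := EM (exists i, ord_le (OSucc a) (f i)); first by left.
  right=> i; have [/= hi|//] := IHf i.
  by case: h; exists i.
move=> b; have [[i hi]|h] := EM (exists i, ord_le (OSucc b) (f i)).
  by right; exists i.
by left=> i; have [//|hi] := IH i b; case: h; exists i.
Qed.

(* The properties of the set of ordinals below a rank. *)
Record segment (Q : ord -> Prop) : Prop := Segment {
  segment_le : forall a b, ord_le a b -> Q b -> Q a;
  segment_sup : forall I (i0 : I) f, (forall i, Q (f i)) -> Q (OSup i0 f) }.

(** Well-foundedness of ranks, by induction on an omitted ordinal. If [R i] omits [OSucc a] and no
    member of the family omits [a], then by totality everything in [R i] is at most [a], hence lies
    in every member. *)
Lemma segment_min (I : Type) (S : set I) (R : I -> ord -> Prop) a i :
  (forall i, segment (R i)) -> S i -> ~ R i a ->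
  exists2 j, S j & forall k, S k -> forall b, R j b -> R k b.
Proof.
move=> sR; elim: a i => [|a IH|J j0 f IH] i Si nRi.
- by exists i => // k _ b Rib; case: nRi; apply: segment_le Rib.
- have [[j Sj nRj]|h] := EM (exists2 j, S j & ~ R j a); first exact: IH nRj.
  exists i => // k Sk b Rib; have [ba|ab] := ord_le_total b a.
    apply: (segment_le (sR k) ba); apply: contrapT => nk.
    by apply: h; exists k.
  by case: nRi; apply: segment_le Rib.
- have [j nj] : exists j, ~ R i (f j).
    apply: contrapT => h; apply: nRi; apply: segment_sup => // j.
    by apply: contrapT => nj; apply: h; exists j.
  exact: IH nj.
Qed.

(** By closure under suprema an omitted supremum has an omitted term; descending from [a] one meets
    an omitted successor of a member. *)
Lemma segment_value (Q : ord -> Prop) a : segment Q -> Q OZero -> ~ Q a ->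
  exists2 b, Q b & ~ Q (OSucc b).
Proof.
move=> sQ Q0; elim: a => [//|a IH|I i0 f IH] nQ.
  have [Qa|/IH//] := EM (Q a).
  by exists a.
have [i ni] : exists i, ~ Q (f i).
  apply: contrapT => h; apply: nQ; apply: segment_sup => // i.
  by apply: contrapT => ni; apply: h; exists i.
exact: IH ni.
Qed.

(** * Monotonicity and invariance of the rank *)

Section Rank.
Variables (L : language) (M : structure L).
Variable D : forall n, set (set (formula L 'I_n)).
Variable C : set M.

Local Notation fr := (frank_ge D C C).

Lemma frank_sub A n (p q : set (pformula M n)) a :
  p `<=` q -> frank_ge D C A q a -> frank_ge D C A p a.
Proof.
elim: a p q => [|a IH|I i0 f IH] p q pq /=.
- by move=> [c cC cq]; exists c => // phi /pq/cq.
- move=> [[phi [phiA h1 h2]] h3]; split.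
    exists phi; split => //; [move: h1|move: h2]; apply: IH; exact: setSU.
  by move=> m b bA; have [r Dr h] := h3 m b bA; exists r => //; apply: IH h; exact: setSU.
- by move=> h i; apply: IH (h i).
Qed.

Lemma segment_frank A n (p : set (pformula M n)) : segment (frank_ge D C A p).
Proof.
split=> // a b; elim: a b p => [|a IH|I i0 f IH] b p /=.
- move=> _; elim: b p => //= [b IH|I i0 f IH] p.
    move=> [[phi [_ h _]] _]; apply: IH; apply: frank_sub h; exact: subsetUl.
  by move=> h; apply: IH (h i0).
- elim: b p => [//|b IHb|I i0 f IHb] p /= ab.
    move=> [[phi [phiA h1 h2]] h3]; split.
      by exists phi; split => //; [move: h1|move: h2]; apply: IH.
    by move=> m c cA; have [r Dr h] := h3 m c cA; exists r => //; apply: IH h.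
  by case: ab => i abi h; apply: IHb abi (h i).
- by move=> h hp i; apply: IH hp.
Qed.

Lemma segment_rank A n (p : set (pformula M n)) : segment (rank_in D C A p).
Proof.
split=> [a b ab h B q fB Bp qB|I i0 f h B q fB Bp qB i].
  by have := segment_le (segment_frank A q) ab (h B q fB Bp qB).
exact: h fB Bp qB.
Qed.

(** The renaming inside [inst], for any parameter type; pairs as parameters keep track of both sides
    of an elementary map. *)
Definition vars n m (V : Type) (a : 'I_m -> V) (i : 'I_(n + m)) : 'I_n + V :=
  match fintype.split i with inl j => inl j | inr k => inr (a k) end.

Lemma inst_image n m (V : Type) (f : V -> M) (q : set (formula L 'I_(n + m))) (a : 'I_m -> V) :
  fmap (param_map f) @` (fmap (vars a) @` q) = inst q (f \o a).
Proof.
rewrite image_comp; congr image; apply/funext => phi /=.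
by rewrite fmap_comp; apply: fmap_eq => i _; rewrite /vars /=; case: (fintype.split i).
Qed.

Lemma pullback n (f : M * M -> M) G (phi : pformula M n) :
  params phi `<=` f @` G ->
  exists2 psi : formula L ('I_n + M * M), (forall x, ffree psi (inr x) -> G x) &
    fmap (param_map f) psi = phi.
Proof.
move=> phiG.
have /choice[h hP] : forall y, exists x, params phi y -> G x /\ f x = y.
  move=> y; have [/phiG[x Gx <-]|ny] := EM (params phi y); first by exists x.
  by exists (y, y).
exists (fmap (param_map h) phi).
  by move=> x; rewrite ffree_fmap => -[[i|y] //= /hP[? _] [<-]].
rewrite fmap_comp -[RHS]fmap_id; apply: fmap_eq => -[i|y] //= /hP[_ ->] //.
Qed.

Definition formulas_over n (G : set (M * M)) : set (formula L ('I_n + M * M)) :=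
  [set phi | forall x, ffree phi (inr x) -> G x].

(** Types over the domain and over the range of [G] become readings of formulas with parameters in
    [G], the form required by [frank_invariant]. *)
Lemma tp_image n (f : M * M -> M) G (c : 'I_n -> M) :
  fmap (param_map f) @` (formulas_over (n := n) G `&` [set phi | sat phi (assign c f)])
    = tp c (f @` G).
Proof.
apply/seteqP; split => [_ [phi [phiG sphi] <-]|phi [phiG sphi]].
  split; last by rewrite psat_param_map.
  by rewrite /over_params /= params_param_map => _ [x /phiG ? <-]; exists x.
have [psi psiG psiE] := pullback phiG.
by exists psi => //; split => //=; rewrite -psat_param_map psiE.
Qed.

Lemma converse_fst (G : set (M * M)) : fst @` converse G = snd @` G.
Proof.
by apply/seteqP; split => x [[u v] Guv <-]; exists (v, u).
Qed.

Lemma converse_snd (G : set (M * M)) : snd @` converse G = fst @` G.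
Proof. by rewrite -[in RHS](converseK G) converse_fst. Qed.

Lemma converse_setU_range n (G : set (M * M)) (c d : 'I_n -> M) :
  converse (G `|` range (fun i => (c i, d i))) = converse G `|` range (fun i => (d i, c i)).
Proof.
by apply/seteqP; split => -[u v] [Guv|[i _ [<- <-]]]; [left|right; exists i|left|right; exists i].
Qed.

Lemma finite_converse (G : set (M * M)) : finite_set G -> finite_set (converse G).
Proof.
move=> /(finite_image (fun p => (p.2, p.1))); apply: sub_finite_set => -[u v] Guv.
by exists (v, u).
Qed.

Hypothesis extC : extensible C C.

(** A back-and-forth argument by induction on [a]: formulas in clause (a) are moved forward and
    tuples in clause (b) backward, each time enlarging [G] by finitely many pairs. *)
Lemma frank_invariant n (P : set (formula L ('I_n + M * M))) G a :
  finite_set G -> elementary G -> fst @` G `<=` C -> snd @` G `<=` C ->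
  P `<=` formulas_over (n := n) G ->
  fr (fmap (param_map fst) @` P) a -> fr (fmap (param_map snd) @` P) a.
Proof.
elim: a P G => [|a IH|I i0 f IH] P G fG eG GC GC' PG /=.
- move=> [c cC cP].
  have [d dC ed] := extensible_tuple extC fG eG GC GC' cC.
  exists d => // _ [phi Pphi <-]; rewrite psat_param_map.
  have /elementary_types/(_ phi (PG _ Pphi)) := ed; apply.
  by rewrite -psat_param_map; apply: cP; exists phi.
- move=> [[phi [phiC h1 h2]] h3]; split.
    have [H [GH fH eH HE HC]] := extensible_finite extC fG eG GC GC'
      (@finite_preimage _ _ (ffree phi) inr ltac:(by move=> ? ? _ _ []) (finite_ffree phi)) phiC.
    have [|psi psiH psiE] := @pullback n fst H phi.
      by rewrite HE; exact: subsetUr.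
    have HC' : fst @` H `<=` C by rewrite HE subUset.
    have PH : P `<=` formulas_over (n := n) H.
      by move=> chi /PG chiG x /chiG; exact: GH.
    exists (fmap (param_map snd) psi); split.
    + rewrite /over_params /= params_param_map => _ [x /psiH Hx <-].
      by apply: HC; exists x.
    + rewrite -image_set1 -image_setU; apply: IH fH eH HC' HC _ _.
        by rewrite subUset; split => // _ ->.
      by rewrite image_setU image_set1 psiE.
    + rewrite -[Not _]/(fmap (param_map snd) (Not psi)).
      rewrite -image_set1 -image_setU; apply: IH fH eH HC' HC _ _.
        by rewrite subUset; split => // _ -> x /= [/psiH|].
      by rewrite image_setU image_set1 /= psiE.
  move=> m b bC.
  have [||b' b'C eb] := extensible_tuple extC (finite_converse fG) (elementary_converse eG) _ _ bC.
  + by rewrite converse_fst.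
  + by rewrite converse_snd.
  have [q Dq hq] := h3 m b' b'C; exists q => //.
  move: hq; rewrite -(inst_image fst q (fun i => (b' i, b i))).
  rewrite -(inst_image snd q (fun i => (b' i, b i))) -!image_setU.
  apply: (IH _ (G `|` range (fun i => (b' i, b i)))).
  + by rewrite finite_setU; split => //; exact: finite_range.
  + by rewrite -[G]converseK -converse_setU_range; exact: elementary_converse.
  + by rewrite image_setU subUset; split => // _ [_ [i _ <-] <-]; apply: b'C; exists i.
  + by rewrite image_setU subUset; split => // _ [_ [i _ <-] <-]; apply: bC; exists i.
  + rewrite subUset; split; first by move=> chi /PG chiG x /chiG; left.
    move=> _ [chi _ <-] x; rewrite ffree_fmap => -[v _]; rewrite /vars.
    by case: (fintype.split v) => [//|i [<-]]; right; exists i.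
- by move=> h i; apply: IH fG eG GC GC' PG (h i).
Qed.

(** The types of [c] and of [b] over [G] are preserved separately; their joint type does not enter,
    since the two sets of formulas are merely united. *)
Lemma frank_tp_invariant n G (c d : 'I_n -> M) m (q : set (formula L 'I_(n + m)))
    (b b' : 'I_m -> M) a :
  finite_set G -> elementary (G `|` range (fun i => (c i, d i))) ->
  elementary (G `|` range (fun i => (b i, b' i))) ->
  fst @` G `<=` C -> snd @` G `<=` C -> range b `<=` C -> range b' `<=` C ->
  fr (tp c (fst @` G) `|` inst q b) a -> fr (tp d (snd @` G) `|` inst q b') a.
Proof.
move=> fG ecd eb GC GC' bC bC'.
rewrite -(tp_image fst) -(tp_image snd).
have -> : formulas_over (n := n) G `&` [set phi | sat phi (assign d snd)] =
    formulas_over (n := n) G `&` [set phi | sat phi (assign c fst)].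
  apply/seteqP; split => phi [phiG sphi]; split => //=; last first.
    by move/elementary_types: ecd; exact.
  apply: contrapT => nphi.
  by move/elementary_types: ecd => /(_ (Not phi)) h; apply: h sphi => // x [/phiG|].
rewrite -(inst_image fst q (fun i => (b i, b' i))).
rewrite -(inst_image snd q (fun i => (b i, b' i))) -!image_setU.
apply: (@frank_invariant _ _ (G `|` range (fun i => (b i, b' i)))) => //.
- by rewrite finite_setU; split => //; exact: finite_range.
- by rewrite image_setU subUset; split => // _ [_ [i _ <-] <-]; apply: bC; exists i.
- by rewrite image_setU subUset; split => // _ [_ [i _ <-] <-]; apply: bC'; exists i.
- rewrite subUset; split; first by move=> phi [phiG _] x /phiG; left.
  move=> _ [phi _ <-] x; rewrite ffree_fmap => -[v _]; rewrite /vars.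
  by case: (fintype.split v) => [//|i [<-]]; right; exists i.
Qed.

End Rank.

(** * Stationary and big types *)

Section Types.
Variables (L : language) (M : structure L).

Lemma complete_consistent n (A : set M) (p : set (pformula M n)) phi :
  complete_type A p -> p phi -> ~ p (Not phi).
Proof.
move=> [_ _ fsat] pphi pnphi.
have [||c cq] := fsat [set phi; Not phi]; first exact: finite_set2.
  by move=> _ [->|->].
by have /(_ (cq phi (or_introl erefl))) := cq (Not phi) (or_intror erefl).
Qed.

Lemma complete_eq n (A : set M) (p q : set (pformula M n)) :
  complete_type A p -> complete_type A q -> p `<=` q -> p = q.
Proof.
move=> cp cq pq; apply/seteqP; split => // phi qphi.
have [qA _ _] := cq; have [_ /(_ phi (qA _ qphi))[//|/pq nphi] _] := cp.
by case: (complete_consistent cq qphi nphi).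
Qed.

Lemma complete_realized n (A : set M) (p : set (pformula M n)) c :
  complete_type A p -> realizes c p -> p = tp c A.
Proof.
move=> cp cpr; apply: complete_eq (cp) (tp_complete A c) _ => phi pphi.
by split; [have [pA _ _] := cp; exact: pA|exact: cpr].
Qed.

Lemma finite_params n (phi : pformula M n) : finite_set (params phi).
Proof.
apply: (@finite_preimage _ _ (ffree phi) inr); first by move=> ? ? _ _ [].
exact: finite_ffree.
Qed.

Lemma dom_complete n (A : set M) (p : set (pformula M n)) :
  complete_type A p -> dom p = A.
Proof.
move=> [pA pc _]; apply/seteqP; split => [x [phi /pA phiA]|x Ax]; first exact: phiA.
pose phi : pformula M n := Eq (Var L (inr x)) (Var L (inr x)).
have [|h|h] := pc phi; first by move=> y [] [->].
- by exists phi => //; left.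
- by exists (Not phi) => //; left; left.
Qed.

Lemma dom_tp n (A : set M) (c : 'I_n -> M) : dom (tp c A) = A.
Proof. exact: dom_complete (tp_complete A c). Qed.

Lemma tp_sub n (A B : set M) (c : 'I_n -> M) : A `<=` B -> tp c A `<=` tp c B.
Proof. by move=> AB phi [phiA sphi]; split => //; exact: subset_trans AB. Qed.

Lemma restr_tp n (A B : set M) (c : 'I_n -> M) : B `<=` A -> restr (tp c A) B = tp c B.
Proof.
move=> BA; apply/seteqP; split => [phi [[_ ?] ?]//|phi [phiB sphi]].
by split => //; split => //; exact: subset_trans BA.
Qed.

Lemma restr_restr n (A B : set M) (p : set (pformula M n)) : B `<=` A ->
  restr (restr p A) B = restr p B.
Proof.
move=> BA; apply/seteqP; split => [phi [[? _] ?]//|phi [pphi phiB]].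
by split => //; split => //; exact: subset_trans BA.
Qed.

Lemma realizes_sub n (p q : set (pformula M n)) c : p `<=` q -> realizes c q -> realizes c p.
Proof. by move=> pq cq phi /pq/cq. Qed.

Lemma realizes_tp n (A : set M) (c : 'I_n -> M) : realizes c (tp c A).
Proof. by move=> phi []. Qed.

Lemma fst_diagonal (A : set M) : fst @` diag_on A = A.
Proof.
by apply/seteqP; split => [_ [p [Ap _] <-]//|x Ax]; exists (x, x).
Qed.

Lemma snd_diagonal (A : set M) : snd @` diag_on A = A.
Proof.
by apply/seteqP; split => [_ [p [Ap ->] <-]//|x Ax]; exists (x, x).
Qed.

Lemma converse_diagonal (A : set M) : converse (diag_on A) = diag_on A.
Proof.
by apply/seteqP; split => -[x y] [/= Ax yx]; split => //=; rewrite -?yx // yx.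
Qed.

Lemma finite_diagonal (A : set M) : finite_set A -> finite_set (diag_on A).
Proof.
move=> /(finite_image (fun x => (x, x))); apply: sub_finite_set => -[x y] [/= Ax ->].
by exists x.
Qed.

(** Through this translation, facts about elementary maps apply to types over [A]. *)
Lemma realizes_tpP n (A : set M) (c d : 'I_n -> M) :
  realizes d (tp c A) <-> elementary (diag_on A `|` range (fun i => (c i, d i))).
Proof.
rewrite elementary_types; split=> [dc phi phiA sphi|h phi [phiA sphi]].
  rewrite -psat_param_map; apply: dc; split.
    by rewrite /over_params /= params_param_map => _ [p /phiA[Ap p21] <-]; rewrite p21.
  rewrite psat_param_map (sat_eq (e' := assign c fst)) // => -[i|p] //=.
  by move=> /phiA[].
have := h (fmap (param_map (fun x => (x, x))) phi).
rewrite !sat_fmap psatE.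
have -> : assign c fst \o @param_map n _ _ (fun x : M => (x, x)) = assign c id.
  by apply/funext => -[].
have -> : assign d snd \o @param_map n _ _ (fun x : M => (x, x)) = assign d id.
  by apply/funext => -[].
apply; last by rewrite -psatE.
by move=> p; rewrite ffree_fmap => -[[i|x] //= /phiA Ax [<-]].
Qed.

Lemma vars_pullback n m (f : 'I_m -> M) (i0 : 'I_m) (phi : pformula M n) :
  params phi `<=` range f -> exists psi, fmap (vars (n := n) f) psi = phi.
Proof.
move=> phif.
(* [i0] is a default index for elements that are not parameters of [phi]. *)
have /choice[k kP] : forall y, exists i, params phi y -> f i = y.
  move=> y; have [/phif[i _ <-]|ny] := EM (params phi y); first by exists i.
  by exists i0.
exists (fmap (fun v => match v with inl i => unsplit (inl i) | inr y => unsplit (inr (k y)) end) phi).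
rewrite fmap_comp -[RHS]fmap_id; apply: fmap_eq => -[i|y] fy; rewrite /= /vars.
  by rewrite (unsplitK (inl i)).
by rewrite (unsplitK (inr (k y))) (kP y fy).
Qed.

Variable D : forall n, set (set (formula L 'I_n)).

Lemma D_set_realizes n (A : set M) (a c : 'I_n -> M) :
  D_set D (A `|` range a) -> realizes c (tp a A) -> D_set D (A `|` range c).
Proof.
move=> DA /realizes_tpP/D_set_elementary h.
have : D_set D (snd @` (diag_on A `|` range (fun i => (a i, c i)))).
  apply: h; apply: D_set_sub DA.
  by rewrite image_setU fst_diagonal; apply: setUS => _ [_ [i _ <-] <-]; exists i.
apply: D_set_sub; rewrite image_setU snd_diagonal; apply: setUS => _ [i _ <-].
by exists (a i, c i) => //; exists i.
Qed.

Lemma S_D_tp n (A : set M) (a : 'I_n -> M) : D_set D (A `|` range a) -> S_D D A (tp a A).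
Proof.
move=> DA; split; first exact: tp_complete.
by move=> c; exact: D_set_realizes.
Qed.

End Types.

(** * Finite bases and generic extensions *)

Section Diagram.
Variables (L : language) (T : set (formula L void)) (M : structure L).
Variable D : forall n, set (set (formula L 'I_n)).
Variables (C : set M) (X : Type).
Hypothesis satM : saturated M.
Hypothesis DT : forall n, @D n `<=` @types_of L T n.
Hypothesis infX : infinite_set [set: X].
Hypothesis leXC : ([set: X] #<= C)%card.
Hypothesis ltCM : card_lt C [set: M].
Hypothesis homC : homogeneous D [set: X] C.
Hypothesis ttD : totally_transcendental D C.

Local Notation fr := (frank_ge D C C).

Let DC : D_set D C. Proof. by case: homC => -[]. Qed.

Let extC : extensible C C. Proof. exact: extensible_ambient infX homC. Qed.

Let DU (A B : set M) : A `<=` C -> B `<=` C -> D_set D (A `|` B).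
Proof. by move=> AC BC; apply: D_set_sub DC; rewrite subUset; split. Qed.

(* [p] has rank exactly [b], and clause (b) in the definition of
   [R(p) >= b + 1] holds; hence clause (a) fails, so that [p] has at most one
   extension of rank [b]. *)
Definition based n (p : set (pformula M n)) (b : ord) : Prop :=
  [/\ fr p b, ~ fr p (OSucc b) & forall m (a : 'I_m -> M), range a `<=` C ->
    exists2 q, @D (n + m) q & fr (p `|` inst q a) b].

(* For [based p b], the unique extension of [p] of rank [b] over [C]. *)
Definition generic n (p : set (pformula M n)) (b : ord) : set (pformula M n) :=
  [set phi | over_params C phi /\ fr (p `|` [set phi]) b].

Lemma based_split n (p : set (pformula M n)) b phi : based p b -> over_params C phi ->
  fr (p `|` [set phi]) b -> ~ fr (p `|` [set Not phi]) b.
Proof. by move=> [_ np pb] phiC h1 h2; apply: np; split => //; exists phi. Qed.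

(** Clause (b) at an enumeration [f] of [F] gives a complete type [q], which decides every formula
    over [F]. So [tp d F] can be added to [p] without losing rank, and by [based_split] no other
    formula over [F] is generic. *)
Lemma generic_finite n (p : set (pformula M n)) b F : based p b ->
  finite_set F -> F `<=` C ->
  exists d, [/\ range d `<=` C, realizes d p, fr (p `|` tp d F) b
    & restr (generic p b) F = tp d F].
Proof.
move=> bp fF FC; have [_ _ pb] := bp.
have [[[x0 Cx0] _ _] _] : D_model D C by case: homC.
(* Adding [x0] makes the tuple nonempty, so that a default index exists. *)
have [m [f fE]] : exists m (f : 'I_m -> M), range f = x0 |` F.
  by apply: finite_set_enum; rewrite finite_setU; split.
have [i0 _ _] : range f x0 by rewrite fE; left.
have [q Dq hq] : exists2 q, @D (n + m) q & fr (p `|` inst q f) b.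
  by apply: pb; rewrite fE subUset; split => // _ ->.
have [d dC dp] := segment_le (segment_frank D C C _) (a := OZero) I hq.
have [N [c [_ qE]]] := DT Dq.
have tpq : tp d F `<=` inst q f.
  move=> phi [phiF sphi].
  have [|psi psiE] := vars_pullback (f := f) i0 (phi := phi).
    by rewrite fE => x /phiF; right.
  exists psi => //; rewrite qE; apply: contrapT => npsi.
  have : psat d (fmap (vars f) (Not psi)).
    by apply: dp; right; exists (Not psi) => //; rewrite qE.
  by rewrite /= psiE; apply.
have hd : fr (p `|` tp d F) b by apply: frank_sub hq; exact: setUS.
exists d; split => //; first by apply: realizes_sub dp; exact: subsetUl.
apply/seteqP; split => [phi [[phiC hphi] phiF]|phi tphi].
  split => //; apply: contrapT => nphi; case: (based_split bp phiC hphi).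
  apply: frank_sub hd; apply: setUS => _ ->; split => // x.
  by case=> [/phiF|].
split; last by case: tphi.
split; first by case: tphi => phiF _; exact: subset_trans FC.
by apply: frank_sub hd; apply: setUS => _ ->.
Qed.

(** Completeness, consistency and the [D]-set property concern only finite parts of [B], where the
    generic type is the type of a tuple of [C]. *)
Lemma generic_S_D n (p : set (pformula M n)) b B : based p b -> B `<=` C ->
  S_D D B (restr (generic p b) B).
Proof.
move=> bp BC.
have gF F : finite_set F -> F `<=` B -> exists d, [/\ range d `<=` C,
    realizes d p & restr (restr (generic p b) B) F = tp d F].
  move=> fF FB; have [d [dC dp _ dE]] := generic_finite bp fF (subset_trans FB BC).
  by exists d; split => //; rewrite restr_restr.
split; first split.
- by move=> phi [].
- move=> phi phiB; have [d [_ _ dE]] := gF (params phi) (finite_params phi) phiB.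
  have [_ /(_ phi (@subset_refl _ _))h _] := tp_complete (params phi) d.
  by rewrite -dE in h; case: h => -[]; [left|right].
- move=> q fq qB; have [||d [_ _ dE]] := gF (dom q).
  + apply: bigcup_finite => // phi _.
    exact: finite_params.
  + by move=> x [phi /qB[_ phiB] /phiB].
  exists d; apply: realizes_sub (@realizes_tp _ _ _ (dom q) d); rewrite -dE => phi qphi.
  by split; [exact: qB|move=> x phix; exists phi].
- move=> c cB k e eBc; have [||d [dC _ dE]] := gF (range e `&` B).
  + by apply: finite_setIl; exact: finite_range.
  + exact: subIsetr.
  have /(_ k e) : D_set D (range e `&` B `|` range c).
    apply: (D_set_realizes (a := d)).
      by apply: DU => // x [_ /BC].
    by rewrite -dE; apply: realizes_sub cB => phi [].
  apply=> x ex; have [Bx|cx] := eBc x ex; [by left|by right].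
Qed.

(** Adding to [p] a formula of [r] gives a part of [r] with finitely many parameters, still of rank
    at least [b]. So [r] consists of generic formulas, and completeness gives equality. *)
Lemma generic_unique n (p r : set (pformula M n)) b B : based p b ->
  finite_set (dom p) -> B `<=` C -> p `<=` r -> complete_type B r ->
  rank D C r b -> r = restr (generic p b) B.
Proof.
move=> bp fp BC pr cr rb.
have [cg _] := generic_S_D bp BC.
apply: complete_eq (cr) cg _ => phi rphi; have [rB _ _] := cr.
split; last exact: rB.
split; first by apply: subset_trans BC; exact: rB.
apply: (rb (dom p `|` params phi)).
- rewrite finite_setU; split => //.
  exact: finite_params.
- by move=> x [[psi /pr rpsi psix]|phix]; [exists psi|exists phi].
- move=> psi [ppsi|->]; split => //; first exact: pr.
    by move=> x psix; left; exists psi.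
  by move=> x; right.
Qed.

(** Two bounds meet: [r] has rank at least [b], and at most the rank of [p], which is [b]. *)
Lemma based_rank n (p r : set (pformula M n)) b : based p b -> finite_set (dom p) ->
  p `<=` r -> rank D C r b -> rank D C r = fr p.
Proof.
move=> [_ np _] fp pr rb; apply/funext => a; apply/propext; split=> [h|pa].
  apply: (h (dom p)) => //; first by move=> x [phi /pr]; exists phi.
  by move=> phi pphi; split; [exact: pr|move=> x phix; exists phi].
have [ab|/segment_le/(_ pa) //] := ord_le_total a b.
  by have := segment_le (segment_rank D C C r) ab rb.
by move=> h; case: np; apply: h; exact: segment_frank.
Qed.

Lemma sub_generic n (p : set (pformula M n)) b : based p b -> dom p `<=` C ->
  p `<=` generic p b.
Proof.
move=> [pb _ _] pC phi pphi; split; first by move=> x phix; apply: pC; exists phi.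
by apply: frank_sub pb => psi [//|->].
Qed.

Lemma rank_generic n (p : set (pformula M n)) b B : based p b ->
  finite_set (dom p) -> dom p `<=` B -> B `<=` C ->
  rank D C (restr (generic p b) B) = fr p.
Proof.
move=> bp fp pB BC; apply: based_rank (bp) fp _ _.
  move=> phi pphi; split; first by apply: sub_generic pphi => //; exact: subset_trans BC.
  by move=> x phix; apply: pB; exists phi.
move=> E q fE EB qE.
have EC : E `<=` C.
  by move=> x /EB[phi [_ phiB] /phiB/BC].
have [d [_ _ hd dE]] := generic_finite bp fE EC.
apply: frank_sub hd => phi /qE[[gphi _] phiE]; right.
by rewrite -dE.
Qed.

Lemma based_stationary n (p r : set (pformula M n)) b : based p b ->
  finite_set (dom p) -> p `<=` r -> dom r `<=` C -> rank D C r b ->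
  stationary D C r.
Proof.
move=> bp fp pr rC rb B BC rB.
have pB : dom p `<=` B by move=> x [phi /pr rphi phix]; apply: rB; exists phi.
have rE := based_rank bp fp pr rb.
exists (restr (generic p b) B); split.
  split; first exact: generic_S_D.
  - move=> phi rphi; have phiB : params phi `<=` B by move=> x phix; apply: rB; exists phi.
    split => //; split; first exact: subset_trans BC.
    apply: (rb (dom p `|` params phi)).
    + rewrite finite_setU; split => //.
      exact: finite_params.
    + by move=> x [[psi /pr rpsi psix]|phix]; [exists psi|exists phi].
    + move=> psi [ppsi|->]; split => //; first exact: pr.
        by move=> x psix; left; exists psi.
      by move=> x; right.
  - by rewrite rank_generic.
move=> r' [[cr' _] rr' rkr']; apply/esym; apply: generic_unique => //.
  exact: subset_trans rr'.
by rewrite rkr'.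
Qed.

(** [F] is chosen with [restr r F] of least rank. For clause (b), the extension of [r] to [C] of the
    same rank is realized by some [c], and the type of [c] with the given tuple [e] is the required
    [q]. *)
Lemma stationary_based n (r : set (pformula M n)) : stationary D C r -> dom r `<=` C ->
  exists F b, [/\ finite_set F, F `<=` dom r, based (restr r F) b
    & rank D C r = fr (restr r F)].
Proof.
move=> sr rC; have [rA [[[cA DA] rrA rkA] _]] := sr C (@subset_refl _ C) rC.
(* [c] need not lie in [C], but [DA] makes [C] together with [c] a [D]-set. *)
have [c cr] := satM ltCM cA.
have rAE := complete_realized cA cr.
have DCc : D_set D (C `|` range c) by exact: DA.
have [a na] := ttD (A := C) (p := r) (@subset_refl _ C)
  (fun phi rphi x phix => rC x (ex_intro2 _ _ phi rphi phix)).
have [E [fE Er nE]] : exists E, [/\ finite_set E, E `<=` dom r & ~ fr (restr r E) a].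
  apply: contrapT => h; apply: na => E q fE Er qE; apply: contrapT => nq.
  by apply: h; exists E; split => // /(frank_sub qE).
have [F [fF Fr] Fmin] := segment_min (S := [set E | finite_set E /\ E `<=` dom r])
  (R := fun E => fr (restr r E)) (fun E => segment_frank D C C _) (conj fE Er) nE.
have nF : ~ fr (restr r F) a by move=> /(Fmin E (conj fE Er)).
have rkE : rank D C r = fr (restr r F).
  apply/funext => b; apply/propext; split; first by move=> h; apply: (h F).
  by move=> hb E' q fE' E'r qE'; apply: frank_sub qE' _; exact: Fmin hb.
have FC : F `<=` C by exact: subset_trans rC.
have F0 : fr (restr r F) OZero.
  have [||d dC dF] := homC.2 _ F (tp c F) FC.
  - exact: finite_card_lt.
  - by apply: S_D_tp; apply: D_set_sub DCc; exact: setSU.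
  exists d => //; apply: realizes_sub dF => phi [rphi phiF]; split => //.
  by apply: cr; exact: rrA.
have [b Fb nFb] := segment_value (segment_frank D C C (restr r F)) F0 nF.
exists F, b; split => //; split => // m e eC.
pose g := assign c e \o @fintype.split n m.
exists (tp0 g).
  apply: DCc => _ [i _ <-]; rewrite /g /=; case: (fintype.split i) => j /=.
    by right; exists j.
  by left; apply: eC; exists j.
have : rank D C rA b by rewrite rkA rkE.
move=> /(_ (F `|` range e)); apply.
- by rewrite finite_setU; split => //; exact: finite_range.
- by rewrite (dom_complete cA) subUset; split.
move=> phi [[rphi phiF]|[psi spsi <-]].
  by split; [exact: rrA|move=> x /phiF; left].
have pe : params (fmap (vars (n := n) e) psi) `<=` range e.
  move=> x; rewrite /params /= ffree_fmap => -[v _]; rewrite /vars.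
  by case: (fintype.split v) => // j [<-]; exists j.
split; last by move=> x /pe; right.
rewrite rAE; split; first by move=> x /pe/eC.
rewrite psatE sat_fmap; move: spsi; rewrite /tp0 /=; congr sat.
by apply/funext => i; rewrite /g /= /vars; case: (fintype.split i).
Qed.

(** * Types over extensible models and bigness *)

(** [E] minimizes the rank of [tp a E]. For clause (b) at [e] in [C], copy [e] over [E] to [e'] in
    [N]; the type of [a] with [e'] works at [e'] by minimality, and invariance of the rank returns
    to [e]. *)
Lemma tp_based N n (a : 'I_n -> M) F : extensible C N -> N `<=` C -> range a `<=` C ->
  finite_set F -> F `<=` N ->
  exists E b, [/\ finite_set E, F `<=` E, E `<=` N, based (tp a E) b
    & forall E', finite_set E' -> E' `<=` N -> forall b', fr (tp a E) b' -> fr (tp a E') b'].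
Proof.
move=> extN NC aC fF FN.
have [b0 nb0] := ttD (p := tp a N) (@subset_refl _ C)
  (fun phi tphi => subset_trans tphi.1 NC).
have [E0 [fE0 FE0 E0N nE0]] : exists E, [/\ finite_set E, F `<=` E, E `<=` N & ~ fr (tp a E) b0].
  apply: contrapT => h; apply: nb0 => E q fE EN qE; apply: contrapT => nq.
  rewrite dom_tp in EN.
  apply: h; exists (F `|` E); split.
  - by rewrite finite_setU.
  - exact: subsetUl.
  - by rewrite subUset.
  - move=> hb; apply: nq; apply: frank_sub hb => phi /qE[[_ sphi] phiE].
    by split => // x /phiE; right.
have [E [fE FE EN] Emin] := segment_min
  (S := [set E | [/\ finite_set E, F `<=` E & E `<=` N]])
  (R := fun E => fr (tp a E)) (fun E => segment_frank D C C _) (And3 fE0 FE0 E0N) nE0.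
have Emin' E' : finite_set E' -> E' `<=` N -> forall b', fr (tp a E) b' -> fr (tp a E') b'.
  move=> fE' E'N b' hb.
  have [h1 h2] : finite_set (F `|` E') /\ F `|` E' `<=` N by rewrite finite_setU subUset.
  have := Emin (F `|` E') (And3 h1 (@subsetUl _ F E') h2) b' hb.
  by apply: frank_sub; apply: tp_sub; exact: subsetUr.
have nE : ~ fr (tp a E) b0 by move=> /(Emin E0 (And3 fE0 FE0 E0N)).
have EC := subset_trans EN NC.
have E00 : fr (tp a E) OZero by exists a => //; exact: realizes_tp.
have [b Eb nEb] := segment_value (segment_frank D C C (tp a E)) E00 nE.
exists E, b; split => //; split => // m e eC.
have [||e' e'N ee'] := extensible_tuple extN (finite_diagonal fE)
  (@elementary_diagonal _ M E) _ _ eC.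
- by rewrite fst_diagonal.
- by rewrite snd_diagonal.
pose g := assign a e' \o @fintype.split n m.
have e'C := subset_trans e'N NC.
exists (tp0 g).
  apply: DC => _ [i _ <-]; rewrite /g /=; case: (fintype.split i) => j /=.
    by apply: aC; exists j.
  by apply: e'C; exists j.
rewrite -[E in tp a E]snd_diagonal.
apply: (frank_tp_invariant extC (finite_diagonal fE) (c := a) (b := e')) => //.
- exact/realizes_tpP/realizes_tp.
- by rewrite -converse_diagonal -converse_setU_range; exact: elementary_converse.
- by rewrite fst_diagonal.
- by rewrite snd_diagonal.
rewrite fst_diagonal.
have hb : fr (tp a (E `|` range e')) b.
  apply: Emin' => //; first by rewrite finite_setU; split => //; exact: finite_range.
  by rewrite subUset.
apply: frank_sub hb; rewrite subUset; split; first by apply: tp_sub; exact: subsetUl.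
move=> _ [psi spsi <-]; split.
  move=> x; rewrite /params /= ffree_fmap => -[v _].
  by case: (fintype.split v) => // j [<-]; right; exists j.
rewrite psatE sat_fmap; move: spsi; rewrite /tp0 /=; congr sat.
by apply/funext => i; rewrite /g /=; case: (fintype.split i).
Qed.

(** If a realization [c] over [N] lay in [N], the equations of the variables with the entries of [c]
    would be generic. This forces [b] to be zero; a realization of [p] other than [c] then gives the
    negation of some equation rank at least [b] as well, against [based_split]. *)
Lemma generic_big n (p : set (pformula M n)) b (d1 d2 : 'I_n -> M) F : based p b ->
  range d1 `<=` C -> range d2 `<=` C -> realizes d1 p -> realizes d2 p -> d1 <> d2 ->
  big_finite D X C (restr (generic p b) F).
Proof.
move=> bp d1C d2C d1p d2p d12 N [DN NC Nsm] FN.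
have [c cC cN] := homC.2 _ _ _ NC Nsm (generic_S_D bp NC).
exists c; split => //.
  apply: realizes_sub cN => phi [gphi phiF]; split => // x phix.
  by apply: FN; exists phi.
move=> cN'; have cfin := finite_range c.
have [d [dC dp hd dE]] := generic_finite bp cfin cC.
pose eqn i : pformula M n := Eq (Var L (inl i)) (Var L (inr (c i))).
have eqnc i : over_params (range c) (eqn i) by move=> x [//|[->]]; exists i.
have td i : tp d (range c) (eqn i).
  have [_ /(_ _ (eqnc i))[//|tn] _] := tp_complete (range c) d.
  have : psat c (Not (eqn i)).
    apply: cN; move: tn; rewrite -dE => -[gn nc]; split => //.
    exact: subset_trans cN'.
  by case.
have bc e : realizes e (tp d (range c)) -> e = c.
  by move=> ed; apply/funext => i; have := ed _ (td i).
(* For larger [b], clause (a) would yield two realizations of [tp d (range c)] that disagree on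
   [phi], although both equal [c]. *)
have b0 : ord_le b OZero.
  have [//|h] := ord_le_total b OZero.
  have /= [[phi [_ [e _ he] [e' _ he']]] _] := segment_le (segment_frank D C C _) h hd.
  have ec : e = c by apply: bc => psi tpsi; apply: he; left; right.
  have e'c : e' = c by apply: bc => psi tpsi; apply: he'; left; right.
  have /(_ (he phi (or_intror erefl))) : psat e (Not phi).
    by rewrite ec -e'c; apply: he'; right.
  by [].
have [d' [d'C d'p d'c]] : exists d', [/\ range d' `<=` C, realizes d' p & d' <> c].
  have [e|ne] := EM (d1 = c); last by exists d1.
  by exists d2; split => // e'; apply: d12; rewrite e e'.
have [i ni] : exists i, d' i <> c i.
  apply: contrapT => h; apply: d'c; apply/funext => i; apply: contrapT => ni.
  by apply: h; exists i.
have [phiC hi] : generic p b (eqn i).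
  by have []: restr (generic p b) (range c) (eqn i) by rewrite dE; exact: td.
case: (based_split bp phiC hi); apply: segment_le b0 _; first exact: segment_frank.
exists d' => // phi [/d'p//|->] /= e.
by case: ni.
Qed.

Lemma extensible_realizes N (F : set M) n (d : 'I_n -> M) : extensible C N -> N `<=` C ->
  finite_set F -> F `<=` N -> range d `<=` C ->
  exists2 e, range e `<=` N & realizes e (tp d F).
Proof.
move=> extN NC fF FN dC.
have [||e eN ee] := extensible_tuple extN (finite_diagonal fF)
  (@elementary_diagonal _ M F) _ _ dC.
- by rewrite fst_diagonal; exact: subset_trans NC.
- by rewrite snd_diagonal.
by exists e => //; exact/realizes_tpP.
Qed.

Lemma tp_generic n (a : 'I_n -> M) E F b : based (tp a E) b -> F `<=` E -> E `<=` C ->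
  tp a F = restr (generic (tp a E) b) F.
Proof.
move=> bE FE EC; have FC := subset_trans FE EC.
apply: complete_eq; [exact: tp_complete|by case: (generic_S_D bE FC)|].
move=> phi [phiF sphi]; split => //; apply: sub_generic => //; first by rewrite dom_tp.
by split => //; exact: subset_trans FE.
Qed.

(** A finite base [tp a E] from [tp_based] is realized by [a], not contained in [N], and by a copy
    inside [N], so [generic_big] applies. *)
Lemma tp_big N n (a : 'I_n -> M) F : small_extensible D X C N -> finite_set F -> F `<=` N ->
  range a `<=` C -> ~ (range a `<=` N) -> big_finite D X C (tp a F).
Proof.
move=> [[DN NC _] extN] fF FN aC naN.
have [E [b [fE FE EN bE Emin]]] := tp_based extN NC aC fF FN.
have [a' a'N a'E] := extensible_realizes extN NC fE EN aC.
rewrite (tp_generic bE FE (subset_trans EN NC)).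
apply: (generic_big bE aC (subset_trans a'N NC)).
- exact: realizes_tp.
- exact: a'E.
- by move=> aa'; apply: naN; rewrite aa'.
Qed.

Lemma big_tpP n (a : 'I_n -> M) A : range a `<=` C -> A `<=` C ->
  big D X C (tp a A) <-> forall F, finite_set F -> F `<=` A -> big_finite D X C (tp a F).
Proof.
move=> aC AC; rewrite /big dom_tp; split => h F fF FA.
  by rewrite -(restr_tp a FA); exact: h.
by rewrite restr_tp //; exact: h.
Qed.

(* A realization [c] of [tp a F] outside a copy [N1] of [N] containing [F] is
   moved to [a] over [F], and [N1] is carried along. *)
Lemma big_tp_model N n (a : 'I_n -> M) F : small_extensible D X C N -> finite_set F -> F `<=` C ->
  range a `<=` C -> big_finite D X C (tp a F) ->
  exists2 N', small_extensible D X C N' & F `<=` N' /\ ~ (range a `<=` N').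
Proof.
move=> sN fF FC aC bigF; have [[DN NC _] extN] := sN.
have [||||H [_ fH eH HE HN]] := extensible_finite (G := set0) extN _ _ _ _ fF FC => //.
- exact: elementary_set0.
- by rewrite image_set0.
- by rewrite image_set0.
rewrite image_set0 set0U in HE.
have [||G [HG eG GE GC sN1]] := small_extensible_image infX homC sN
  (finite_converse fH) (elementary_converse eH).
- by rewrite converse_fst; exact: subset_trans NC.
- by rewrite converse_snd HE.
set N1 := [set y | _] in sN1.
have FN1 : F `<=` N1.
  move=> x; rewrite -HE => -[[u v] Huv /= <-]; exists v.
    by apply: HN; exists (u, v).
  exact: HG.
have [c [cC cF ncN1]] : exists c, [/\ range c `<=` C, realizes c (tp a F) & ~ (range c `<=` N1)].
  by apply: bigF; [case: sN1|rewrite dom_tp].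
have eca : elementary (diag_on F `|` range (fun i => (c i, a i))).
  by rewrite -converse_diagonal -converse_setU_range; apply: elementary_converse; exact/realizes_tpP.
have [|||G' [HG' eG' _ _ sN2]] := small_extensible_image infX homC sN1 _ eca.
- by rewrite finite_setU; split; [exact: finite_diagonal|exact: finite_range].
- by rewrite image_setU fst_diagonal subUset; split => // _ [_ [i _ <-] <-]; apply: cC; exists i.
- by rewrite image_setU snd_diagonal subUset; split => // _ [_ [i _ <-] <-]; apply: aC; exists i.
eexists; first exact: sN2.
split; first by move=> x Fx; exists x; [exact: FN1|apply: HG'; left].
move=> h; apply: ncN1 => _ [i _ <-].
have [x N1x Gx] := h (a i) (imageT _ _).
suff -> : c i = x by [].
apply/(elementary_inj eG' _ Gx) => //.
by apply: HG'; right; exists i.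
Qed.

(** * Minimal types *)

Lemma S_D_tp_ambient n (a : 'I_n -> M) A : range a `<=` C -> A `<=` C -> S_D D A (tp a A).
Proof. by move=> aC AC; apply: S_D_tp; apply: D_set_sub DC; rewrite subUset. Qed.

Lemma S_D_realized n (A : set M) (p : set (pformula M n)) : A `<=` C ->
  card_lt A [set: X] -> S_D D A p -> exists2 d, range d `<=` C & p = tp d A.
Proof.
move=> AC Asm Sp; have [d dC dp] := homC.2 _ _ _ AC Asm Sp.
by exists d => //; apply: complete_realized dp; case: Sp.
Qed.

Lemma rank_tpP n (a : 'I_n -> M) A b :
  rank D C (tp a A) b <-> forall F, finite_set F -> F `<=` A -> fr (tp a F) b.
Proof.
split=> [h F fF FA|h F q fF]; first by apply: (h F) => //; rewrite ?dom_tp ?restr_tp.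
by rewrite dom_tp => FA; rewrite restr_tp // => qF; apply: frank_sub qF _; exact: h.
Qed.

Lemma rank_tp_finite n (a : 'I_n -> M) F : finite_set F -> rank D C (tp a F) = fr (tp a F).
Proof.
move=> fF; apply/funext => b; apply/propext; rewrite rank_tpP; split; first exact.
by move=> h E _ EF; apply: frank_sub h; exact: tp_sub.
Qed.

Lemma based_tp_stationary n (a : 'I_n -> M) F b : finite_set F -> F `<=` C ->
  based (tp a F) b -> stationary D C (tp a F).
Proof.
move=> fF FC bF; apply: (based_stationary bF) => //; rewrite ?dom_tp //.
by rewrite rank_tp_finite //; case: bF.
Qed.

(** A big stationary type of least rank is cut down to a finite base [F] of the same rank, and [c]
    enumerates [F]. *)
Lemma minimal_exists N : small_D_model D X C N -> homogeneous D [set: nat] N ->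
  exists k (c : 'I_k -> M) (q : set (pformula M 1)), minimal_over D X C N c q.
Proof.
move=> sN homN; have [_ NC Nsm] := sN.
have extN : extensible C N by apply: homogeneous_extensible homN => //; exact: infinite_nat.
(* [N] is smaller than [X], hence cannot contain [C]; the type of such a point [x] over a finite
   base in [N] shows that some big stationary type has bounded rank. *)
have [x Cx Nx] : exists2 x, C x & ~ N x.
  apply: contrapT => h; case: Nsm => _; apply; apply: card_le_trans leXC _.
  by apply: subset_card_le => x Cx; apply: contrapT => Nx; apply: h; exists x.
pose a (_ : 'I_1) := x.
have aC : range a `<=` C by move=> _ [i _ <-].
have aN : ~ range a `<=` N by move=> h; apply: Nx; apply: h; exists ord0.
have [E [b [fE _ EN bE Emin]]] := tp_based extN NC aC (finite_set0 M) (@sub0set _ N).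
pose S (r : set (pformula M 1)) := exists A, [/\ A `<=` N, S_D D A r, big D X C r & stationary D C r].
have SE : S (tp a E).
  exists E; split => //; first by apply: S_D_tp_ambient => //; exact: subset_trans NC.
    apply/big_tpP => // [|F fF FE]; first exact: subset_trans NC.
    exact: (tp_big (conj sN extN) fF (subset_trans FE EN) aC aN).
  by apply: based_tp_stationary bE => //; exact: subset_trans NC.
have nE : ~ rank D C (tp a E) (OSucc b) by rewrite rank_tp_finite //; case: bE.
have [r [A [AN Sr bigr statr]] rmin] := segment_min (R := fun r => rank D C r)
  (fun r => segment_rank D C C r) SE nE.
have AC := subset_trans AN NC.
have [d dC rE] := S_D_realized AC (card_lt_le (subset_card_le AN) Nsm) Sr.
have domr : dom r = A by rewrite rE dom_tp.
have [|F [b' [fF FA bF rkF]]] := stationary_based statr.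
  by rewrite domr.
rewrite domr in FA.
have FC := subset_trans FA AC.
have rFE : restr r F = tp d F by rewrite rE restr_tp.
rewrite rFE in bF rkF.
have [k [c cF]] := finite_set_enum fF.
exists k, c, (tp d F); rewrite /minimal_over cF; split.
- exact: subset_trans AN.
- exact: S_D_tp_ambient.
- apply/big_tpP => // F' fF' F'F.
  rewrite rE in bigr; have /(big_tpP dC AC) := bigr; apply => //.
  exact: subset_trans FA.
- exact: based_tp_stationary bF.
- move=> A' r' A'N Sr' bigr' statr' e; rewrite rank_tp_finite // -rkF.
  by apply: rmin; exists A'.
Qed.

(** The maps from [a'] to [a], from [a] to [e] and from [e] to [e'] are composed. *)
Lemma realizes_tp_transport n G (a a' e e' : 'I_n -> M) :
  elementary (G `|` range (fun i => (a i, a' i))) ->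
  elementary (G `|` range (fun i => (e i, e' i))) ->
  realizes e (tp a (fst @` G)) -> realizes e' (tp a' (snd @` G)).
Proof.
move=> ea ee /realizes_tpP eae; apply/realizes_tpP.
apply: elementary_sub (elementary_comp (elementary_converse ea) (elementary_comp eae ee)).
move=> [u v] [[/= [[w u'] Gwu /= <-] ->]|[i _ [<- <-]]].
  exists w; first by left.
  by exists w; left => //; split => //; exists (w, u').
exists (a i); first by right; exists i.
by exists (e i); right; exists i.
Qed.

Lemma frank_tp n G (c d : 'I_n -> M) b :
  finite_set G -> elementary (G `|` range (fun i => (c i, d i))) ->
  fst @` G `<=` C -> snd @` G `<=` C -> range c `<=` C -> range d `<=` C ->
  fr (tp c (fst @` G)) b -> fr (tp d (snd @` G)) b.
Proof.
move=> fG ecd GC GC' cC dC.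
(* With [set0] for [q] only the types remain; the second [c] and [d] are dummy instances. *)
have := @frank_tp_invariant _ _ D C extC n G c d n set0 c d b fG ecd ecd GC GC' cC dC.
by rewrite /inst !image_set0 !setU0.
Qed.

Lemma based_tp_transport n G (c d : 'I_n -> M) b :
  finite_set G -> elementary (G `|` range (fun i => (c i, d i))) ->
  fst @` G `<=` C -> snd @` G `<=` C -> range c `<=` C -> range d `<=` C ->
  based (tp c (fst @` G)) b -> based (tp d (snd @` G)) b.
Proof.
move=> fG ecd GC GC' cC dC [h1 h2 h3].
have fG' := finite_converse fG.
have eG' : elementary (converse G).
  by apply: elementary_converse; apply: elementary_sub ecd; exact: subsetUl.
have cG'C : fst @` converse G `<=` C by rewrite converse_fst.
have cG'C' : snd @` converse G `<=` C by rewrite converse_snd.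
split; first exact: frank_tp h1.
  move=> h; apply: h2.
  have := @frank_tp _ (converse G) d c (OSucc b) fG' _ cG'C cG'C' dC cC.
  rewrite converse_fst converse_snd; apply => //.
  by rewrite -converse_setU_range; exact: elementary_converse.
move=> m e eC.
have [e' e'C ee'] := extensible_tuple extC fG' eG' cG'C cG'C' eC.
have [q Dq hq] := h3 m e' e'C; exists q => //.
apply: frank_tp_invariant hq => //.
by rewrite -[G]converseK -converse_setU_range; exact: elementary_converse.
Qed.

(* Transport to [N] of a finite [E] over which [a] has a small rank gives a big
   stationary type over a subset of [N] of the same rank. *)
Lemma big_rank_le N N' k (c : 'I_k -> M) q (a : 'I_1 -> M) F b :
  small_extensible D X C N -> minimal_over D X C N c q ->
  small_extensible D X C N' -> finite_set F -> F `<=` N' ->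
  range a `<=` C -> ~ (range a `<=` N') -> rank D C q b -> fr (tp a F) b.
Proof.
move=> [[_ NC _] extN] [_ _ _ _ qmin] [[_ N'C _] extN'] fF FN' aC aN' qb.
have [E [b1 [fE _ EN' bE Emin]]] := tp_based extN' N'C aC fF FN'.
apply: (Emin F fF FN').
have EC := subset_trans EN' N'C.
(* [e1] lies in [N'] and so differs from [a]; its image [e1'] is a second realization of the
   transported type, which makes that type big. *)
have [e1 e1N' ae1] := extensible_realizes extN' N'C fE EN' aC.
have e1C := subset_trans e1N' N'C.
have [||H [_ fH eH HE HN]] := extensible_finite extN (finite_set0 (M * M))
  (elementary_set0 (M := M)) _ _ fE EC.
- by rewrite image_set0.
- by rewrite image_set0.
rewrite image_set0 set0U in HE.
have HC := subset_trans HN NC.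
have HEC : fst @` H `<=` C by rewrite HE.
have [a' a'C eaa'] := extensible_tuple extC fH eH HEC HC aC.
have eH1 : finite_set (H `|` range (fun i => (a i, a' i))).
  by rewrite finite_setU; split => //; exact: finite_range.
have [||e1' e1'C ee1] := extensible_tuple extC eH1 eaa' _ _ e1C.
- by rewrite image_setU subUset; split => // _ [_ [i _ <-] <-]; apply: aC; exists i.
- by rewrite image_setU subUset; split => // _ [_ [i _ <-] <-]; apply: a'C; exists i.
have a'e1' : a' <> e1'.
  move=> ae; apply: aN' => _ [i _ <-]; suff -> : a i = e1 i by apply: e1N'; exists i.
  apply/(elementary_inj ee1 (y := a' i) (y' := e1' i)); last by rewrite ae.
    by left; right; exists i.
  by right; exists i.
have e1'E : realizes e1' (tp a' (snd @` H)).
  apply: (realizes_tp_transport eaa' (e := e1)); last by rewrite HE.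
  by apply: elementary_sub ee1 => p [Hp|]; [left; left|right].
have bE' : based (tp a' (snd @` H)) b1.
  by apply: (based_tp_transport fH eaa') => //; rewrite HE.
have fH' : finite_set (snd @` H) by exact: finite_image.
suff rb : rank D C (tp a' (snd @` H)) b.
  rewrite rank_tp_finite // in rb.
  have := @frank_tp _ (converse H) a' a b (finite_converse fH) _ _ _ a'C aC.
  rewrite converse_fst converse_snd HE; apply => //.
  by rewrite -converse_setU_range; exact: elementary_converse.
apply: (qmin _ _ HN) qb.
- exact: S_D_tp_ambient.
- apply/big_tpP => // F' fF' F'H; rewrite (tp_generic bE' F'H HC).
  by apply: (generic_big bE' a'C e1'C) => //; exact: realizes_tp.
- exact: based_tp_stationary bE'.
Qed.

Lemma homogeneous_nat_extensible N : small_D_model D X C N -> homogeneous D [set: nat] N ->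
  small_extensible D X C N.
Proof.
move=> sN homN; split => //; apply: homogeneous_extensible homN => //.
exact: infinite_nat.
Qed.

(** If the type is big, each finite [F] lies in a small model omitting [a], and [big_rank_le] bounds
    the rank over [F] below by that of [q]. Conversely, independence makes the type the generic
    extension of a finite base of [q], which has two realizations. *)
Lemma minimal_bigP k (c : 'I_k -> M) q (A B : set M) qA (a : 'I_1 -> M) :
  minimal D X C c q -> A `<=` C -> range c `<=` A -> B `<=` C ->
  free_extension D C q A qA -> range a `<=` C -> realizes a qA ->
  big D X C (tp a (A `|` B)) <-> indep D C a A B.
Proof.
move=> [N [sN homN qmin]] AC cA BC [[cqA _] qqA rkqA] aC aqA.
have eN := homogeneous_nat_extensible sN homN.
have [[_ NC Nsm] extN] := eN.
have [cN Sq bigq statq _] := qmin.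
have qAE := complete_realized cqA aqA.
rewrite {}qAE in qqA rkqA cqA.
have ABC : A `|` B `<=` C by rewrite subUset.
rewrite /indep; split=> [bigAB|indAB].
  apply/funext => b; apply/propext; split; last first.
    by rewrite !rank_tpP => h F fF FA; apply: h => //; exact: subset_trans (@subsetUl _ _ _).
  rewrite rkqA => qb; apply/rank_tpP => F fF FAB.
  have FC := subset_trans FAB ABC.
  have [|N' eN' [FN' aN']] := big_tp_model eN fF FC aC.
    by have /(big_tpP aC ABC) := bigAB; apply.
  exact: (big_rank_le eN qmin eN' fF FN' aC aN' qb).
have fc := finite_range c.
have cC := subset_trans cN NC.
have domq : dom q = range c by apply: dom_complete; case: Sq.
have [|F [b [fF Fc bF rkF]]] := stationary_based statq; first by rewrite domq.
(* Bigness of [q] gives [d1] outside [N], and [d2] is a copy inside [N]: two realizations for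
   [generic_big]. *)
have [d1 [d1C d1q d1N]] : exists d1, [/\ range d1 `<=` C, realizes d1 q & ~ range d1 `<=` N].
  have [||d1 [d1C d1q d1N]] := bigq (range c) fc _ N sN.
  - by rewrite domq.
  - by move=> x [phi [_ phic] /phic/cN].
  exists d1; split => // phi qphi; apply: d1q; split => //.
  by case: Sq => -[qc _ _] _; exact: qc.
have [d2 d2N d2q] := extensible_realizes extN NC fc cN d1C.
have qE : q = tp d1 (range c) by apply: complete_realized d1q; case: Sq.
have rAB : tp a (A `|` B) = restr (generic (restr q F) b) (A `|` B).
  apply: generic_unique => //.
  - by apply: sub_finite_set fF => x [phi [_ phiF] /phiF].
  - by move=> phi [/qqA[phiA sphi] _]; split => // x /phiA; left.
  - exact: tp_complete.
  - by rewrite -indAB rkqA rkF; case: bF.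
apply/big_tpP => // E fE EAB.
have -> : tp a E = restr (generic (restr q F) b) E.
  by rewrite -(restr_tp a EAB) rAB restr_restr.
have sqF : restr q F `<=` q by move=> phi [].
apply: (generic_big bF d1C (subset_trans d2N NC)).
- exact: realizes_sub d1q.
- by apply: realizes_sub sqF _; rewrite qE.
- by move=> d12; apply: d1N; rewrite d12.
Qed.

(** Independence is read as bigness. Where [tp b F2] is not big, [b] lies in every small extensible
    model containing [F2]; so a model omitting [a] and containing [F2] contains [b] too. *)
Lemma minimal_regular k (c : 'I_k -> M) q : minimal D X C c q -> regular D X C (range c) q.
Proof.
move=> minq; have [N [sN homN [cN Sq bigq statq _]]] := minq.
have eN := homogeneous_nat_extensible sN homN.
have cC : range c `<=` C by apply: subset_trans cN _; case: sN.
split => // B a b BC aC aq bC bq ia ib.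
have fq : free_extension D C q (range c) q by split => //; exact: subset_refl.
have indP (E : set M) (e : 'I_1 -> M) : E `<=` C -> range e `<=` C -> realizes e q ->
    (big D X C (tp e (range c `|` E)) <-> indep D C e (range c) E).
  by move=> EC eC eq; exact: minimal_bigP minq cC (@subset_refl _ (range c)) EC fq eC eq.
have bBC : B `|` range b `<=` C by rewrite subUset.
apply/(indP _ _ bBC aC aq).
have cBC : range c `|` B `<=` C by rewrite subUset.
have cBbC : range c `|` (B `|` range b) `<=` C by rewrite subUset.
have /(big_tpP aC cBC) bigA : big D X C (tp a (range c `|` B)) by apply/(indP _ _ BC aC aq).
have [F2 [fF2 F2B nF2]] : exists F, [/\ finite_set F, F `<=` range c `|` B & ~ big_finite D X C (tp b F)].
  apply: contrapT => h; apply: ib; apply/(indP _ _ BC bC bq)/big_tpP => // F fF FB.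
  by apply: contrapT => nF; apply: h; exists F.
apply/big_tpP => // F fF FB; apply: contrapT => nF.
(* [F3] joins the set over which [b] is not big with the part of [F] from [c] and [B]; the rest of
   [F] comes from [b]. *)
pose F3 := F2 `|` (F `&` (range c `|` B)).
have fF3 : finite_set F3 by rewrite finite_setU; split => //; exact: finite_setIl.
have F3B : F3 `<=` range c `|` B by rewrite subUset; split => // x [].
have [N' eN' [F3N' aN']] := big_tp_model eN fF3 (subset_trans F3B cBC) aC (bigA F3 fF3 F3B).
have bN' : range b `<=` N'.
  apply: contrapT => nb; apply: nF2; apply: (tp_big eN') => // x F2x.
  by apply: F3N'; left.
apply: nF; apply: (tp_big eN') => // x Fx.
have [cx|[Bx|/bN' //]] := FB x Fx; apply: F3N'; right; split => //; by [left|right].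
Qed.

End Diagram.

Theorem theorem4p14
    (L : language) (T : set (formula L void)) (Mbar : structure L)
    (D : forall n, set (set (formula L 'I_n))) (C : set Mbar) (X : Type)
    (hT : models Mbar T) (hsat : saturated Mbar)
    (hD : forall n, D n `<=` @types_of L T n)
    (hTX : card_lt [set: formula L nat] [set: X])
    (hXC : ([set: X] #<= C)%card)
    (hCM : card_lt C [set: Mbar])
    (hC : homogeneous D [set: X] C)
    (htt : totally_transcendental D C) :
  (forall M : set Mbar, small_D_model D X C M -> homogeneous D [set: nat] M ->
     exists k (c : 'I_k -> Mbar) (q : set (pformula Mbar 1)),
       minimal_over D X C M c q) /\
  (forall k (c : 'I_k -> Mbar) (q : set (pformula Mbar 1)),
     minimal D X C c q ->
     regular D X C (range c) q /\
     (forall (A B : set Mbar) (qA : set (pformula Mbar 1)) (a : 'I_1 -> Mbar),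
        A `<=` C -> range c `<=` A -> B `<=` C ->
        free_extension D C q A qA -> range a `<=` C -> realizes a qA ->
        (big D X C (tp a (A `|` B)) <-> indep D C a A B))).
Proof.
have infX : infinite_set [set: X].
  apply/infiniteP; apply: card_le_trans (proj1 hTX).
  (* These formulas are pairwise distinct, so there are infinitely many formulas. *)
  pose eqn n : formula L nat := Eq (Var L 0) (Var L n).
  have /inj_card_eq : {in [set: nat] &, injective eqn} by move=> m n _ _ [].
  rewrite card_eq_le => /andP[_ h]; apply: card_le_trans h _.
  exact: subset_card_le.
split=> [N sN homN|k c q minq]; first exact: minimal_exists homN.
split=> [|A B qA a AC cA BC fqA aC aqA]; first exact: minimal_regular minq.
exact (minimal_bigP hsat hD infX hCM hC htt minq AC cA BC fqA aC aqA).
Qed.
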